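(* Let $w$ be either the empty word or a word in the letters $x_0,x_1$ ending in $x_1$, and let $s\ge3$ be an integer. Then $$\sum_{n=1}^\infty\frac{H_{n-1}(w)}{n^s}\left[4^{-n}\binom{2n}{n}\right]^{-2}\in\mathsf{CMZV}^4_{s+|w|}.$$
   Context: A nonempty word ending in $x_1$ can be written uniquely as $w=x_0^{t_1-1}x_1\cdots x_0^{t_k-1}x_1$ with $t_j$ positive integers; its weight is $|w|=t_1+\cdots+t_k$, and $H_M(w)=\sum_{M\ge m_1>\cdots>m_k\ge1}\frac{1}{m_1^{t_1}\cdots m_k^{t_k}}$ for $M\ge0$ (so $H_0(w)=0$). For the empty word, $|w|=0$ and $H_M(w)=1$. For positive integers $s_1,\dots,s_k$ and complex $a_j$, $L_{s_1,\dots,s_k}(a_1,\dots,a_k)=\sum_{n_1>\cdots>n_k\ge1}\frac{a_1^{n_1}\cdots a_k^{n_k}}{n_1^{s_1}\cdots n_k^{s_k}}$. For integers $N\ge1$, $W\ge1$, $\mathsf{CMZV}^N_W$ is the $\mathbb{Q}$-linear span of all $L_{s_1,\dots,s_k}(a_1,\dots,a_k)$ with $k\ge1$, $s_1+\cdots+s_k=W$, each $a_j$ an $N$-th root of unity, and $(s_1,a_1)\ne(1,1)$. *)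

(* Defs.v *)
From Stdlib Require Import Reals QArith Qreals List Factorial.
From Coquelicot Require Import Coquelicot.
Open Scope R_scope.

(* A word ending in x1 (or empty) w = x0^{t1-1}x1 ... x0^{tk-1}x1 is represented
   by its list of exponents [t1; ...; tk] (all positive); the empty word is [].  *)
Definition word_ok (w : list nat) : Prop := List.Forall (fun t => (0 < t)%nat) w.

Definition weight (w : list nat) : nat := fold_right Nat.add 0%nat w.

(* H_M(w) = sum_{M >= m1 > ... > mk >= 1} 1/(m1^t1 ... mk^tk); H_M([]) = 1. *)
Fixpoint H (M : nat) (w : list nat) {struct M} : R :=
  match w with
  | nil => 1
  | t :: w' =>
    match M with
    | O => 0
    | S M' => H M' w + / (INR M ^ t) * H M' w'
    end
  end.

Definition central_binom (n : nat) : R :=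
  INR (fact (2 * n)) / (INR (fact n) ^ 2).

Definition term (w : list nat) (s n : nat) : R :=
  H (n - 1) w / (INR n ^ s) * / ((/ 4 ^ n * central_binom n) ^ 2).

Fixpoint Cpow (a : C) (n : nat) : C :=
  match n with
  | O => RtoC 1
  | S n' => Cmult a (Cpow a n')
  end.

(* Partial sums of the multiple polylogarithm over N >= n1 > ... > nk >= 1,
   for data [(s1,a1); ...; (sk,ak)]. *)
Fixpoint Lpart (N : nat) (d : list (nat * C)) {struct N} : C :=
  match d with
  | nil => RtoC 1
  | (s, a) :: d' =>
    match N with
    | O => RtoC 0
    | S N' => Cplus (Lpart N' d)
                    (Cmult (Cmult (Cpow a N) (Cinv (RtoC (INR N ^ s)))) (Lpart N' d'))
    end
  end.

Definition is_L (d : list (nat * C)) (v : C) : Prop :=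
  filterlim (fun N => Lpart N d) eventually (locally v).

Definition admissible (N W : nat) (d : list (nat * C)) : Prop :=
  match d with
  | nil => False
  | (s1, a1) :: _ =>
      (s1 <> 1%nat \/ a1 <> RtoC 1) /\
      List.Forall (fun p => (0 < fst p)%nat /\ Cpow (snd p) N = RtoC 1) d /\
      fold_right Nat.add 0%nat (map fst d) = W
  end.

Definition in_CMZV (N W : nat) (z : C) : Prop :=
  exists l : list (Q * list (nat * C) * C),
    List.Forall (fun x => admissible N W (snd (fst x)) /\ is_L (snd (fst x)) (snd x)) l /\
    z = fold_right (fun x acc => Cplus (Cmult (RtoC (Q2R (fst (fst x)))) (snd x)) acc)
                   (RtoC 0) l.

(* Main.v *)
(** With [b_n = 4^-n binom(2n,n)] and [y = sin theta], put
    [f_(w,s) = sum_n H_(n-1)(w) / (n^s b_n) y^(2n)].  Then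
    [d f_(w,s+1) = 2 cot theta f_(w,s) dtheta], and the two-term recurrence for
    [b_n] gives [d (cot theta f_(t w',1)) = 2 f_(w',t) dtheta], starting from
    [cot theta f_(nil,1) = 2 theta].  So [f_(w,s)], for [s >= 2], is an iterated
    integral in [dtheta], [cot theta dtheta], [tan theta dtheta].  Since
    [1 / (n b_n) = 2 int_0^(pi/2) sin^(2n-1)], the sum is
    [2 int_0^(pi/2) f_(w,s-1) dtheta / sin theta].  Under [t = tan (theta/2)] all
    these forms become combinations of [dt/t] and [eta dt / (1 - eta t)] with
    [eta^4 = 1], and [dtheta / sin theta = dt / t].  The coefficients are rational
    except for a factor [i] per [dtheta], and [dtheta] occurs an even number of
    times.  As the outermost form is [dt/t], only absolutely convergent [L]-values
    with first exponent at least [2] occur. *)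
Require Import Defs.
From Stdlib Require Import Reals QArith Qreals List Lra Lia Psatz.
From Coquelicot Require Import Coquelicot.
Open Scope R_scope.

(** * Taylor coefficients of multiple polylogarithms *)

Lemma Defs_Cpow_eq (a : C) (n : nat) : Defs.Cpow a n = Complex.Cpow a n.
Proof. reflexivity. Qed.

(** The Taylor coefficients in [t] of the multiple polylogarithm whose first argument is multiplied
    by [t]; their sum at [t = 1] is the [L]-value. *)
Definition coef (d : list (nat * C)) (n : nat) : C :=
  match n, d with
  | S m, (s, a) :: d' =>
      (Complex.Cpow a n * / RtoC (INR n ^ s) * Lpart m d')%C
  | _, _ => RtoC 0
  end.

Lemma Lpart_nil (N : nat) : Lpart N nil = RtoC 1.
Proof. now destruct N. Qed.

Lemma Lpart_S (N : nat) (d : list (nat * C)) :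
  d <> nil -> Lpart (S N) d = (Lpart N d + coef d (S N))%C.
Proof. destruct d as [|[s a] d]; [easy|]. reflexivity. Qed.

(* [kernel_coef eta z] lists the coefficients of [z(t) * eta t / (1 - eta t)]. *)
Fixpoint kernel_coef (eta : C) (z : nat -> C) (n : nat) : C :=
  match n with
  | O => RtoC 0
  | S m => (eta * (kernel_coef eta z m + z m))%C
  end.

(** The geometric series turns the coefficient into the sum over [k <= m] of [eta^(m+1-k)] times the
    old one; pulling out [eta^(m+1)] replaces [a] by [a / eta]. *)
Lemma kernel_coef_coef (eta a : C) (s : nat) (d : list (nat * C)) (m : nat) :
  eta <> RtoC 0 ->
  kernel_coef eta (coef ((s, a) :: d)) (S m) =
  (Complex.Cpow eta (S m) * Lpart m ((s, (a / eta)%C) :: d))%C.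
Proof.
  intros He; induction m as [|m IH].
  - cbn; ring.
  - change (kernel_coef eta (coef ((s, a) :: d)) (S (S m))) with
      (eta * (kernel_coef eta (coef ((s, a) :: d)) (S m) + coef ((s, a) :: d) (S m)))%C.
    rewrite IH, Lpart_S by discriminate.
    cbn [coef].
    replace (Complex.Cpow (a / eta) (S m))
      with (Complex.Cpow a (S m) / Complex.Cpow eta (S m))%C.
    + rewrite (Cpow_S eta (S m)). field.
      split; [|apply Cpow_nz; exact He].
      intros H. apply RtoC_inj in H. revert H. apply pow_nonzero.
      now apply not_0_INR.
    + unfold Cdiv. rewrite Cpow_mult_l, Cpow_inv by exact He. reflexivity.
Qed.

(** * Rational combinations of coefficient sequences, and integration *)

Definition roots_data (N : nat) (d : list (nat * C)) : Prop :=
  List.Forall (fun p => (0 < fst p)%nat /\ Defs.Cpow (snd p) N = RtoC 1) d.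

(** The case [(s1, a1) = (1, 1)] is allowed here: these data only describe Taylor series inside the
    unit disk. *)
Definition valid (N W : nat) (d : list (nat * C)) : Prop :=
  d <> nil /\ roots_data N d /\
  fold_right Nat.add 0%nat (map fst d) = W.

(** Pointwise equations in the constructors make the class stable under extensional equality, and
    linear operations follow by induction on the derivation. *)
Inductive mpl_seq (N W : nat) : (nat -> C) -> Prop :=
| mpl_seq_zero (z : nat -> C) : (forall n, z n = RtoC 0) -> mpl_seq N W z
| mpl_seq_cons (q : Q) (d : list (nat * C)) (z z' : nat -> C) :
    valid N W d -> mpl_seq N W z' ->
    (forall n, z n = (RtoC (Q2R q) * coef d n + z' n)%C) -> mpl_seq N W z.

Lemma mpl_seq_ext (N W : nat) (z z' : nat -> C) :
  (forall n, z n = z' n) -> mpl_seq N W z -> mpl_seq N W z'.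
Proof.
  intros E H; destruct H as [z Hz|q d z z1 Hd H Hz].
  - apply mpl_seq_zero; intros n; now rewrite <- E.
  - apply (mpl_seq_cons _ _ q d _ z1 Hd H); intros n; now rewrite <- E.
Qed.

Lemma mpl_seq_plus (N W : nat) (z z' : nat -> C) :
  mpl_seq N W z -> mpl_seq N W z' -> mpl_seq N W (fun n => (z n + z' n)%C).
Proof.
  intros H H'; induction H as [z Hz|q d z z1 Hd H IH Hz].
  - apply (mpl_seq_ext _ _ z'); [|exact H'].
    intros n; rewrite Hz; ring.
  - apply (mpl_seq_cons _ _ q d _ _ Hd IH).
    intros n; rewrite Hz; ring.
Qed.

Lemma mpl_seq_scal (N W : nat) (q : Q) (z : nat -> C) :
  mpl_seq N W z -> mpl_seq N W (fun n => (RtoC (Q2R q) * z n)%C).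
Proof.
  intros H; induction H as [z Hz|q' d z z1 Hd H IH Hz].
  - apply mpl_seq_zero; intros n; rewrite Hz; ring.
  - apply (mpl_seq_cons _ _ (q * q')%Q d _ _ Hd IH).
    intros n; rewrite Hz, Q2R_mult, RtoC_mult; ring.
Qed.

Lemma mpl_seq_single (N W : nat) (d : list (nat * C)) :
  valid N W d -> mpl_seq N W (coef d).
Proof.
  intros Hd. apply (mpl_seq_cons _ _ 1%Q d _ (fun _ => RtoC 0) Hd).
  - now apply mpl_seq_zero.
  - intros n; replace (Q2R 1) with 1 by (unfold Q2R; simpl; field); ring.
Qed.

Lemma mpl_seq_0 (N W : nat) (z : nat -> C) : mpl_seq N W z -> z O = RtoC 0.
Proof.
  intros H; induction H as [z Hz|q d z z1 Hd H IH Hz]; [apply Hz|].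
  rewrite Hz, IH; simpl; ring.
Qed.

Lemma INR_S_C_nz (n : nat) : RtoC (INR (S n)) <> RtoC 0.
Proof. intros H. apply RtoC_inj in H. revert H. now apply not_0_INR. Qed.

Lemma root_nz (a : C) (N : nat) :
  (0 < N)%nat -> Defs.Cpow a N = RtoC 1 -> a <> RtoC 0.
Proof.
  intros HN H ->. destruct N as [|N]; [easy|].
  cbn in H. rewrite Cmult_0_l in H. apply RtoC_inj in H. lra.
Qed.

(** Integration against [dt/t]: the first exponent grows by one. *)
Lemma mpl_seq_div (N W : nat) (z : nat -> C) :
  mpl_seq N W z -> mpl_seq N (S W) (fun n => (z n / RtoC (INR n))%C).
Proof.
  intros H; induction H as [z Hz|q d z z1 Hd H IH Hz].
  - apply mpl_seq_zero; intros n; rewrite Hz; unfold Cdiv; ring.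
  - destruct Hd as (Hn & Hf & Hw). destruct d as [|[s a] d]; [easy|].
    apply (mpl_seq_cons _ _ q ((S s, a) :: d) _ _) with (2 := IH).
    + split; [discriminate|]. split.
      * inversion_clear Hf as [|? ? [_ Ha] Hf']. constructor; [|exact Hf'].
        split; [simpl; lia|exact Ha].
      * simpl in *; lia.
    + intros [|n]; rewrite Hz.
      * cbn [coef]; unfold Cdiv; ring.
      * cbn [coef]. rewrite <- tech_pow_Rmult, RtoC_mult. field.
        split; [apply INR_S_C_nz|].
        rewrite RtoC_pow. apply Cpow_nz, INR_S_C_nz.
Qed.

(** Integration against [eta dt / (1 - eta t)]: by [kernel_coef_coef] a new pair [(1, eta)] is put
    in front, and [a / eta] is again an [N]-th root of unity. *)
Lemma mpl_seq_int (N W : nat) (eta : C) (z : nat -> C) :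
  (0 < N)%nat -> Defs.Cpow eta N = RtoC 1 ->
  mpl_seq N W z -> mpl_seq N (S W) (fun n => (kernel_coef eta z n / RtoC (INR n))%C).
Proof.
  intros HN He H. assert (Hnz := root_nz _ _ HN He).
  induction H as [z Hz|q d z z1 Hd H IH Hz].
  - apply mpl_seq_zero. intros n.
    replace (kernel_coef eta z n) with (RtoC 0); [unfold Cdiv; ring|].
    induction n as [|n IHn]; simpl; [reflexivity|]. rewrite <- IHn, Hz; ring.
  - destruct Hd as (Hn & Hf & Hw). destruct d as [|[s a] d]; [easy|].
    apply (mpl_seq_cons _ _ q ((1%nat, eta) :: (s, (a / eta)%C) :: d) _ _)
      with (2 := IH).
    + split; [discriminate|]. split.
      * inversion_clear Hf as [|? ? [Hs Ha] Hf'].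
        constructor; [split; [simpl; lia|exact He]|].
        constructor; [|exact Hf']. split; [exact Hs|]. cbn [snd] in *.
        rewrite Defs_Cpow_eq in *. unfold Cdiv.
        rewrite Cpow_mult_l, Cpow_inv, Ha, He by exact Hnz. field.
      * simpl in *; lia.
    + assert (HK : forall n, kernel_coef eta z n =
        (RtoC (Q2R q) * kernel_coef eta (coef ((s, a) :: d)) n + kernel_coef eta z1 n)%C).
      { induction n as [|n IHn]; cbn [kernel_coef]; [ring|]. rewrite IHn, Hz; ring. }
      intros [|n].
      * cbn [kernel_coef coef]; unfold Cdiv; ring.
      * rewrite HK, kernel_coef_coef by exact Hnz. unfold coef at 1.
        rewrite pow_1. field. apply INR_S_C_nz.
Qed.

(** * Growth bounds and convergence at 1 *)

Lemma Cmod_root (a : C) (N : nat) :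
  (0 < N)%nat -> Defs.Cpow a N = RtoC 1 -> Cmod a = 1.
Proof.
  intros HN H. rewrite Defs_Cpow_eq in H. apply (f_equal Cmod) in H.
  rewrite Cmod_pow, Cmod_1 in H. apply pow_R1 in H as [H|H]; [|lia].
  rewrite Rabs_pos_eq in H; [exact H|apply Cmod_ge_0].
Qed.

Lemma Cmod_coef_cons (N s : nat) (a : C) (d : list (nat * C)) (m : nat) :
  (0 < N)%nat -> Defs.Cpow a N = RtoC 1 ->
  Cmod (coef ((s, a) :: d) (S m)) = Cmod (Lpart m d) / INR (S m) ^ s.
Proof.
  intros HN Ha. assert (Hp : 0 < INR (S m)) by (apply lt_0_INR; lia).
  cbn [coef]. rewrite !Cmod_mult, Cmod_pow, (Cmod_root _ _ HN Ha), pow1.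
  rewrite <- RtoC_inv by (apply pow_nonzero; lra).
  rewrite Cmod_R, Rabs_pos_eq by
    (apply Rlt_le, Rinv_0_lt_compat, pow_lt, Hp).
  unfold Rdiv; ring.
Qed.

Lemma INR_S_sqrt (m : nat) :
  1 <= sqrt (INR (S m)) /\ sqrt (INR (S m)) * sqrt (INR (S m)) = INR (S m).
Proof.
  assert (Hp : 1 <= INR (S m)) by (rewrite S_INR; pose proof (pos_INR m); lra).
  split; [|apply sqrt_sqrt; lra].
  rewrite <- sqrt_1. apply sqrt_le_1; lra.
Qed.

(** A square root stands in for the true logarithmic growth: summing [sqrt m / m] gives [O(sqrt n)]
    again, so each nested sum costs only a constant factor. *)
Lemma Lpart_bound (N : nat) (d : list (nat * C)) :
  (0 < N)%nat -> roots_data N d ->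
  exists M, 0 <= M /\ forall n, Cmod (Lpart n d) <= M * sqrt (INR (S n)).
Proof.
  intros HN Hd. induction Hd as [|[s a] d [Hs Ha] Hd IH].
  - exists 1; split; [lra|]. intros n. rewrite Lpart_nil, Cmod_1.
    destruct (INR_S_sqrt n). lra.
  - destruct IH as (M & HM & HB). exists (4 * M). split; [lra|].
    induction n as [|n IHn].
    + cbn [Lpart]. rewrite Cmod_0. destruct (INR_S_sqrt 0). nra.
    + rewrite Lpart_S by discriminate.
      eapply Rle_trans; [apply Cmod_triangle|].
      rewrite (Cmod_coef_cons N) by assumption.
      destruct (INR_S_sqrt n) as [Hu Hu2], (INR_S_sqrt (S n)) as [Hv Hv2].
      set (u := sqrt (INR (S n))) in *. set (v := sqrt (INR (S (S n)))) in *.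
      assert (E : v * v = u * u + 1).
      { rewrite Hv2, Hu2, (S_INR (S n)). reflexivity. }
      assert (Hc : Cmod (Lpart n d) / INR (S n) ^ s <= M / u).
      { destruct s as [|s]; [simpl in Hs; lia|]. rewrite <- Hu2.
        apply Rle_trans with (Cmod (Lpart n d) / (u * u)).
        - apply Rmult_le_compat_l; [apply Cmod_ge_0|].
          apply Rinv_le_contravar; [nra|]. rewrite <- tech_pow_Rmult.
          assert (1 <= (u * u) ^ s) by (apply pow_R1_Rle; nra). nra.
        - apply Rmult_le_reg_r with (u * u); [nra|].
          unfold Rdiv. rewrite Rmult_assoc, Rinv_l, Rmult_1_r by nra.
          replace (M * / u * (u * u)) with (M * u) by (field; lra).
          apply HB. }
      apply Rle_trans with (4 * M * u + M / u).
      { apply Rplus_le_compat; [exact IHn|exact Hc]. }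
      (* Telescoping bound. Cleared of the denominator and squared, with [v^2 = u^2 + 1], it reads
         [8 u^2 >= 1]. *)
      assert (Hi : / u <= 4 * v - 4 * u).
      { apply Rmult_le_reg_r with u; [lra|]. rewrite Rinv_l by lra.
        assert (4 * u * u + 1 <= 4 * u * v); [|lra].
        apply Rsqr_incr_0_var; unfold Rsqr; [|nra].
        assert (16 * u * u * (v * v) = 16 * u * u * (u * u + 1))
          by (rewrite E; reflexivity).
        nra. }
      unfold Rdiv. nra.
Qed.

Lemma coef_bound (N s : nat) (a : C) (d : list (nat * C)) :
  (0 < N)%nat -> Defs.Cpow a N = RtoC 1 -> roots_data N d ->
  exists M, 0 <= M /\ forall m,
    Cmod (coef ((s, a) :: d) (S m)) <= M * sqrt (INR (S m)) / INR (S m) ^ s.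
Proof.
  intros HN Ha Hd. destruct (Lpart_bound N d HN Hd) as (M & HM & HB).
  exists M; split; [exact HM|]. intros m.
  rewrite (Cmod_coef_cons N) by assumption.
  apply Rmult_le_compat_r; [|apply HB].
  apply Rlt_le, Rinv_0_lt_compat, pow_lt, lt_0_INR; lia.
Qed.

(** A first exponent of 1 already absorbs the square root growth. Boundedness then yields a radius
    of convergence of at least 1. *)
Lemma mpl_seq_bounded (N W : nat) (z : nat -> C) :
  (0 < N)%nat -> mpl_seq N W z -> exists M, forall n, Cmod (z n) <= M.
Proof.
  intros HN H. induction H as [z Hz|q d z z1 Hd H [M1 HM1] Hz].
  - exists 0. intros n. rewrite Hz, Cmod_0. lra.
  - destruct Hd as (Hn & Hf & Hw). destruct d as [|[s a] d]; [easy|].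
    inversion_clear Hf as [|? ? [Hs Ha] Hf'].
    destruct (coef_bound N s a d HN Ha Hf') as (M & HM & HB).
    exists (Rabs (Q2R q) * M + M1). intros n. rewrite Hz.
    eapply Rle_trans; [apply Cmod_triangle|].
    apply Rplus_le_compat; [|apply HM1]. rewrite Cmod_mult, Cmod_R.
    apply Rmult_le_compat_l; [apply Rabs_pos|].
    destruct n as [|n]; [cbn [coef]; rewrite Cmod_0; exact HM|].
    eapply Rle_trans; [apply HB|]. destruct (INR_S_sqrt n) as [Hu Hu2].
    destruct s as [|s]; [simpl in Hs; lia|].
    rewrite <- Hu2 at 2. set (u := sqrt (INR (S n))) in *.
    apply Rmult_le_reg_r with ((u * u) ^ S s); [apply pow_lt; nra|].
    unfold Rdiv. rewrite Rmult_assoc, Rinv_l, Rmult_1_r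
      by (apply pow_nonzero; nra).
    apply Rmult_le_compat_l; [exact HM|]. rewrite <- tech_pow_Rmult.
    assert (1 <= (u * u) ^ s) by (apply pow_R1_Rle; nra). nra.
Qed.

(** Comparison of [m^(-3/2)] with the telescoping differences of [4 / sqrt m]. *)
Lemma ex_series_pow_three_halves (M : R) : 0 <= M ->
  ex_series (fun m => M * sqrt (INR (S m)) / INR (S m) ^ 2).
Proof.
  intros HM. set (b := fun m => _).
  assert (Hb : forall m, 0 <= b m /\
    b m <= 4 * M * (/ sqrt (INR (S m)) - / sqrt (INR (S (S m))))).
  { intros m. unfold b. destruct (INR_S_sqrt m) as [Hu Hu2],
      (INR_S_sqrt (S m)) as [Hv Hv2].
    replace (INR (S m) ^ 2) with
      ((sqrt (INR (S m)) * sqrt (INR (S m))) ^ 2) by (rewrite Hu2; reflexivity).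
    assert (E : sqrt (INR (S (S m))) * sqrt (INR (S (S m))) =
      sqrt (INR (S m)) * sqrt (INR (S m)) + 1).
    { rewrite Hv2, Hu2, (S_INR (S m)). reflexivity. }
    set (u := sqrt (INR (S m))) in *. set (v := sqrt (INR (S (S m)))) in *.
    replace (M * u / (u * u) ^ 2) with (M * / (u * u * u)) by (field; lra).
    assert (H3 : 0 < / (u * u * u)) by (apply Rinv_0_lt_compat; nra).
    split; [nra|].
    replace (4 * M * (/ u - / v)) with (M * (4 * (/ u - / v))) by ring.
    apply Rmult_le_compat_l; [exact HM|].
    assert (Huv : 0 < u * v * (u + v)) by nra.
    replace (/ u - / v) with (/ (u * v * (u + v))).
    2:{ apply Rmult_eq_reg_r with (u * v * (u + v)); [|lra].
        rewrite Rinv_l by lra. field_simplify; [nra|lra]. }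
    (* From [v^2 <= 2 u^2] comes [v <= 3u/2], hence [u v (u + v) <= (15/4) u^3]; this explains the
       constant 4. *)
    assert (Hvu : 4 * v <= 6 * u) by nra.
    assert (H4 : u * v * (u + v) <= 4 * (u * u * u)).
    { replace (4 * (u * u * u)) with (u * (4 * (u * u))) by ring.
      rewrite Rmult_assoc. apply Rmult_le_compat_l; nra. }
    apply Rmult_le_reg_r with (u * u * u); [nra|]. rewrite Rinv_l by nra.
    apply Rmult_le_reg_r with (u * v * (u + v)); [lra|].
    replace (4 * / (u * v * (u + v)) * (u * u * u) * (u * v * (u + v)))
      with (4 * (u * u * u)) by (field; lra).
    lra. }
  destruct (ex_finite_lim_seq_incr (sum_n b) (4 * M)) as [l Hl].
  - intros n. rewrite sum_Sn. unfold plus; simpl. destruct (Hb (S n)). lra.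
  - intros n. apply Rle_trans with (4 * M * (1 - / sqrt (INR (S (S n))))).
    + induction n as [|n IH].
      * rewrite sum_O. destruct (Hb 0%nat) as [_ H].
        change (INR 1) with 1 in H. rewrite sqrt_1, Rinv_1 in H. exact H.
      * rewrite sum_Sn. unfold plus; simpl. destruct (Hb (S n)) as [_ H].
        simpl in H, IH |- *. lra.
    + destruct (INR_S_sqrt (S n)) as [Hv _].
      assert (0 < / sqrt (INR (S (S n)))) by (apply Rinv_0_lt_compat; lra).
      nra.
  - exists l. exact Hl.
Qed.

Lemma sum_n_coef (d : list (nat * C)) (n : nat) :
  d <> nil -> sum_n (coef d) n = Lpart n d.
Proof.
  intros Hd. induction n as [|n IH].
  - rewrite sum_O. now destruct d as [|[s a] d].
  - rewrite sum_Sn, IH, Lpart_S by exact Hd. reflexivity.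
Qed.

Lemma ex_series_coef (N s : nat) (a : C) (d : list (nat * C)) :
  (0 < N)%nat -> (2 <= s)%nat -> Defs.Cpow a N = RtoC 1 -> roots_data N d ->
  ex_series (V := C_NormedModule) (coef ((s, a) :: d)).
Proof.
  intros HN Hs Ha Hd. destruct (coef_bound N s a d HN Ha Hd) as (M & HM & HB).
  apply (ex_series_incr_1 (V := C_NormedModule)).
  apply (ex_series_le (V := C_CompleteNormedModule))
    with (2 := ex_series_pow_three_halves M HM).
  intros m. change (Cmod (coef ((s, a) :: d) (S m)) <=
    M * sqrt (INR (S m)) / INR (S m) ^ 2).
  eapply Rle_trans; [apply HB|].
  destruct (INR_S_sqrt m) as [Hu Hu2].
  apply Rmult_le_compat_l; [nra|].
  apply Rinv_le_contravar; [apply pow_lt; nra|].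
  apply Rle_pow; [nra|exact Hs].
Qed.

Lemma in_CMZV_cons (N W : nat) (q : Q) (d : list (nat * C)) (v z : C) :
  admissible N W d -> is_L d v -> in_CMZV N W z ->
  in_CMZV N W (RtoC (Q2R q) * v + z)%C.
Proof.
  intros Hd Hv (l & Hl & ->). exists ((q, d, v) :: l). split; [|reflexivity].
  constructor; [now split|exact Hl].
Qed.

(** The passage from Taylor series to [L]-values. Division by [n] makes every first exponent at
    least 2, which gives both convergence at 1 and admissibility. *)
Lemma mpl_seq_div_series (N W : nat) (z : nat -> C) :
  (0 < N)%nat -> mpl_seq N W z ->
  exists v, is_series (V := C_NormedModule)
      (fun n => (z n / RtoC (INR n))%C) v /\ in_CMZV N (S W) v.
Proof.
  intros HN H. induction H as [z Hz|q d z z1 Hd H (v1 & Hs1 & Hv1) Hz].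
  - exists (RtoC 0). split.
    + apply (is_series_ext (V := C_NormedModule)) with (fun _ => zero).
      * intros n. rewrite Hz. unfold zero, Cdiv; simpl. now rewrite Cmult_0_l.
      * unfold is_series. eapply filterlim_ext; [|apply filterlim_const].
        intros n. induction n as [|n IHn]; [now rewrite sum_O|].
        rewrite sum_Sn, <- IHn. symmetry. exact (plus_zero_r (G := C_AbelianMonoid) _).
    + exists nil. split; [constructor|reflexivity].
  - destruct Hd as (Hn & Hf & Hw). destruct d as [|[s a] d]; [easy|].
    inversion_clear Hf as [|? ? [Hs Ha] Hf'].
    destruct (ex_series_coef N (S s) a d) as (v & Hv); auto; [simpl in Hs; lia|].
    assert (E : forall n, (RtoC (Q2R q) * coef ((S s, a) :: d) n
      + z1 n / RtoC (INR n))%C = (z n / RtoC (INR n))%C).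
    { intros [|n]; rewrite Hz; cbn [coef]; [unfold Cdiv; ring|].
      rewrite <- tech_pow_Rmult, RtoC_mult. field.
      split; [rewrite RtoC_pow; apply Cpow_nz|]; apply INR_S_C_nz. }
    exists (RtoC (Q2R q) * v + v1)%C. split.
    + apply (is_series_ext (V := C_NormedModule)) with
        (fun n => plus (scal (RtoC (Q2R q)) (coef ((S s, a) :: d) n))
                       (z1 n / RtoC (INR n))%C).
      * exact E.
      * apply (is_series_plus (V := C_NormedModule)); [|exact Hs1].
        apply (is_series_scal (V := C_NormedModule) (RtoC (Q2R q))). exact Hv.
    + apply in_CMZV_cons with ((S s, a) :: d); [|clear -Hv|exact Hv1].
      * split; [left; simpl in Hs; lia|]. split.
        -- constructor; [|exact Hf']. split; [simpl; lia|exact Ha].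
        -- simpl in *; lia.
      * unfold is_L. eapply filterlim_ext; [|exact Hv].
        intros n. apply sum_n_coef. discriminate.
Qed.

(** * Real sequences with a parity *)

Lemma CV_radius_ge_1 (a : nat -> R) (M : R) :
  (forall n, Rabs (a n) <= M) -> Rbar_le 1 (CV_radius a).
Proof.
  intros H. apply (proj1 (CV_radius_bounded a)). exists M. intros n.
  rewrite pow1, Rmult_1_r. apply H.
Qed.

Lemma inside_disk (a : nat -> R) (x : R) :
  Rbar_le 1 (CV_radius a) -> Rabs x < 1 -> Rbar_lt (Rabs x) (CV_radius a).
Proof. intros H Hx. now apply Rbar_lt_le_trans with 1. Qed.

(** The flag [e] records the parity of the number of [dtheta] integrations, each of which
    contributes a factor [i]. *)
Definition cunit (e : bool) : C := if e then Ci else RtoC 1.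

(* Real sequences that become rational combinations of level 4 coefficients
   after multiplication by [i] when [e] is [true]. *)
Definition mpl_real (W : nat) (e : bool) (a : nat -> R) : Prop :=
  mpl_seq 4 W (fun n => (RtoC (a n) * cunit e)%C).

Lemma Ci_sqr : (Ci * Ci)%C = RtoC (-1).
Proof. unfold Ci, Cmult, RtoC; simpl. f_equal; ring. Qed.

Lemma Cmod_cunit (e : bool) : Cmod (cunit e) = 1.
Proof. destruct e; [apply Cmod_Ci|apply Cmod_1]. Qed.

Lemma mpl_real_radius (W : nat) (e : bool) (a : nat -> R) :
  mpl_real W e a -> Rbar_le 1 (CV_radius a).
Proof.
  intros H. destruct (mpl_seq_bounded 4 W _ (Nat.lt_0_succ 3) H) as [M HM].
  apply CV_radius_ge_1 with M. intros n. specialize (HM n).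
  rewrite Cmod_mult, Cmod_cunit, Cmod_R, Rmult_1_r in HM. exact HM.
Qed.

Lemma mpl_real_0 (W : nat) (e : bool) (a : nat -> R) :
  mpl_real W e a -> a O = 0.
Proof.
  intros H. apply mpl_seq_0 in H. apply (f_equal Cmod) in H.
  rewrite Cmod_mult, Cmod_cunit, Cmod_R, Cmod_0, Rmult_1_r in H.
  destruct (Req_dec (a O) 0) as [E|E]; [exact E|].
  now apply Rabs_no_R0 in E.
Qed.

Lemma mpl_real_plus (W : nat) (e : bool) (a b : nat -> R) :
  mpl_real W e a -> mpl_real W e b -> mpl_real W e (PS_plus a b).
Proof.
  intros Ha Hb. eapply mpl_seq_ext; [|exact (mpl_seq_plus _ _ _ _ Ha Hb)].
  intros n. unfold PS_plus, plus; simpl. rewrite RtoC_plus. ring.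
Qed.

Lemma mpl_real_scal (W : nat) (e : bool) (q : Q) (a : nat -> R) :
  mpl_real W e a -> mpl_real W e (PS_scal (Q2R q) a).
Proof.
  intros Ha. eapply mpl_seq_ext; [|exact (mpl_seq_scal _ _ q _ Ha)].
  intros n. unfold PS_scal, scal; simpl. unfold mult; simpl.
  rewrite RtoC_mult. ring.
Qed.

Lemma mpl_real_div (W : nat) (e : bool) (a : nat -> R) :
  mpl_real W e a -> mpl_real (S W) e (fun n => a n / INR n).
Proof.
  intros Ha. assert (H0 := mpl_real_0 _ _ _ Ha).
  eapply mpl_seq_ext; [|exact (mpl_seq_div _ _ _ Ha)].
  intros [|n]; cbn beta.
  - rewrite H0. unfold Rdiv, Cdiv. rewrite Rmult_0_l. ring.
  - unfold Rdiv. rewrite RtoC_mult, RtoC_inv by now apply not_0_INR.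
    unfold Cdiv; ring.
Qed.

(* [pq eps a] lists the coefficients of [a(t) * eps t^2 / (1 - eps t^2)] and
   [a(t) * t / (1 - eps t^2)]: the even and odd parts, in a square root [eta]
   of [eps], of the kernel [eta t / (1 - eta t)]. *)
Fixpoint pq (eps : R) (a : nat -> R) (n : nat) : R * R :=
  match n with
  | O => (0, 0)
  | S m => (eps * snd (pq eps a m), fst (pq eps a m) + a m)
  end.

Lemma kernel_coef_pq (eta : C) (eps : R) (e : bool) (a : nat -> R) (n : nat) :
  (eta * eta)%C = RtoC eps ->
  kernel_coef eta (fun k => (RtoC (a k) * cunit e)%C) n =
  ((RtoC (fst (pq eps a n)) + eta * RtoC (snd (pq eps a n))) * cunit e)%C.
Proof.
  intros He. induction n as [|n IH]; cbn [kernel_coef pq fst snd]; [ring|].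
  rewrite IH, RtoC_mult, RtoC_plus, <- He. ring.
Qed.

(* The numerators vanish at [n = 0], so dividing by [INR 0] is harmless. *)
Definition prim_p (eps : R) (a : nat -> R) (n : nat) : R :=
  2 * fst (pq eps a n) / INR n.

Definition prim_q (eps : R) (a : nat -> R) (n : nat) : R :=
  2 * snd (pq eps a n) / INR n.

Lemma RtoC_div_INR (r : R) (n : nat) :
  (n = O -> r = 0) -> RtoC (r / INR n) = (RtoC r / RtoC (INR n))%C.
Proof.
  destruct n as [|n]; intros H.
  - rewrite H by reflexivity. unfold Rdiv, Cdiv. rewrite Rmult_0_l. ring.
  - unfold Rdiv, Cdiv. rewrite RtoC_mult, RtoC_inv by now apply not_0_INR.
    reflexivity.
Qed.

Lemma Defs_Cpow_4 (eta : C) :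
  ((eta * eta) * (eta * eta))%C = RtoC 1 -> Defs.Cpow eta 4 = RtoC 1.
Proof. intros H. transitivity ((eta * eta) * (eta * eta))%C; [cbn; ring|exact H]. Qed.

(** The roots [eta] and [-eta] have the same square, so adding the two integrals cancels the odd
    part and doubles the even one. Since [eps^2 = 1], both are fourth roots of unity. *)
Lemma mpl_real_prim_p (W : nat) (e : bool) (eta : C) (eps : R) (a : nat -> R) :
  (eta * eta)%C = RtoC eps -> eps * eps = 1 ->
  mpl_real W e a -> mpl_real (S W) e (prim_p eps a).
Proof.
  intros He Hs Ha.
  assert (He' : (- eta * - eta)%C = RtoC eps) by (rewrite <- He; ring).
  assert (R1 : Defs.Cpow eta 4 = RtoC 1).
  { apply Defs_Cpow_4. rewrite He, <- RtoC_mult, Hs. reflexivity. }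
  assert (R2 : Defs.Cpow (- eta)%C 4 = RtoC 1).
  { apply Defs_Cpow_4. rewrite He', <- RtoC_mult, Hs. reflexivity. }
  eapply mpl_seq_ext; [|exact (mpl_seq_plus _ _ _ _
    (mpl_seq_int 4 W eta _ (Nat.lt_0_succ 3) R1 Ha)
    (mpl_seq_int 4 W (- eta)%C _ (Nat.lt_0_succ 3) R2 Ha))].
  intros n. cbn beta. rewrite (kernel_coef_pq _ _ _ _ _ He).
  rewrite (kernel_coef_pq _ _ _ _ _ He').
  unfold prim_p. rewrite RtoC_div_INR, RtoC_mult; [unfold Cdiv; ring|].
  intros ->; cbn; ring.
Qed.

(** Subtracting the integrals for [i] and [-i] leaves [2 i] times the odd part; the extra [i] flips
    the parity. *)
Lemma mpl_real_prim_q (W : nat) (e : bool) (a : nat -> R) :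
  mpl_real W e a -> mpl_real (S W) (negb e) (prim_q (-1) a).
Proof.
  intros Ha. assert (He := Ci_sqr).
  assert (He' : (- Ci * - Ci)%C = RtoC (-1)) by (rewrite <- He; ring).
  assert (R1 : Defs.Cpow Ci 4 = RtoC 1).
  { apply Defs_Cpow_4. rewrite He, <- RtoC_mult. f_equal; ring. }
  assert (R2 : Defs.Cpow (- Ci)%C 4 = RtoC 1).
  { apply Defs_Cpow_4. rewrite He', <- RtoC_mult. f_equal; ring. }
  (* For [e = true] the two factors [i] multiply to [-1], which this sign compensates. *)
  set (q := if e then (-1)%Q else 1%Q).
  eapply mpl_seq_ext; [|exact (mpl_seq_plus _ _ _ _
    (mpl_seq_scal _ _ q _ (mpl_seq_int 4 W Ci _ (Nat.lt_0_succ 3) R1 Ha))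
    (mpl_seq_scal _ _ (- q)%Q _
       (mpl_seq_int 4 W (- Ci)%C _ (Nat.lt_0_succ 3) R2 Ha)))].
  intros n. cbn beta. rewrite (kernel_coef_pq _ _ _ _ _ He).
  rewrite (kernel_coef_pq _ _ _ _ _ He').
  unfold prim_q. rewrite RtoC_div_INR, RtoC_mult by (intros ->; cbn; ring).
  rewrite Q2R_opp, RtoC_opp.
  assert (H1 : Q2R 1 = 1) by (unfold Q2R; simpl; field).
  assert (H2 : Q2R (-1) = -1) by (unfold Q2R; simpl; field).
  unfold q; destruct e; cbn [cunit negb]; rewrite ?H1, ?H2; unfold Cdiv.
  - match goal with |- ?l = ?r => replace l with
      ((Ci * Ci) * (RtoC (-1) * RtoC 2 * RtoC (snd (pq (-1) a n)) * / RtoC (INR n)))%C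
      by ring end.
    rewrite He. replace (RtoC (-1)) with (- RtoC 1)%C by
      (rewrite <- RtoC_opp; f_equal; ring). ring.
  - ring.
Qed.

(** * Derivatives of the primitives *)

Lemma PS_derive_div (u : nat -> R) (n : nat) :
  PS_derive (fun n => u n / INR n) n = u (S n).
Proof. unfold PS_derive. field. now apply not_0_INR. Qed.

Lemma PSeries_derive_div (W : nat) (e : bool) (a : nat -> R) (t : R) :
  mpl_real W e a -> t <> 0 ->
  PSeries (PS_derive (fun n => a n / INR n)) t = / t * PSeries a t.
Proof.
  intros Ha Ht.
  rewrite (PSeries_decr_1_aux a t) by exact (mpl_real_0 _ _ _ Ha).
  rewrite (PSeries_ext _ (PS_decr_1 a)) by (intros n; apply PS_derive_div).
  field; exact Ht.
Qed.

Lemma PSeries_inside (a : nat -> R) (x : R) :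
  Rbar_le 1 (CV_radius a) -> Rabs x < 1 -> ex_pseries a x.
Proof. intros H Hx. apply CV_radius_inside. now apply inside_disk. Qed.

Lemma PSeries_derive_prim_q (a : nat -> R) (t : R) :
  Rbar_le 1 (CV_radius a) -> Rbar_le 1 (CV_radius (prim_q (-1) a)) ->
  Rabs t < 1 ->
  PSeries (PS_derive (prim_q (-1) a)) t = 2 / (1 + t ^ 2) * PSeries a t.
Proof.
  intros Hr Hb Ht.
  set (D := PS_derive (prim_q (-1) a)).
  assert (HD : ex_pseries D t).
  { apply PSeries_inside; [|exact Ht]. unfold D.
    rewrite CV_radius_derive; exact Hb. }
  assert (HDn : forall n, D n = 2 * snd (pq (-1) a (S n))).
  { intros n. exact (PS_derive_div (fun n => 2 * snd (pq (-1) a n)) n). }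
  (* Two steps of [pq] give [D_n = 2 a_n - D_(n-2)], that is, [(1 + t^2) D = 2 a]. *)
  assert (E : PSeries D t = - (t * (t * PSeries D t)) + 2 * PSeries a t).
  { rewrite <- !PSeries_incr_1, <- PSeries_opp, <- PSeries_scal, <- PSeries_plus.
    - apply PSeries_ext. intros n.
      unfold PS_plus, PS_opp, PS_scal, plus, opp, scal; simpl.
      unfold mult; simpl. rewrite HDn.
      destruct n as [|[|n]]; cbn; unfold zero; simpl; try ring.
      rewrite HDn. cbn. ring.
    - apply ex_pseries_opp. now do 2 apply ex_pseries_incr_1.
    - apply ex_pseries_scal; [apply Rmult_comm|]. now apply PSeries_inside. }
  apply Rmult_eq_reg_l with (1 + t ^ 2); [|nra].
  replace ((1 + t ^ 2) * (2 / (1 + t ^ 2) * PSeries a t)) with (2 * PSeries a t)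
    by (field; nra). nra.
Qed.

Lemma PSeries_derive_prim_p (W : nat) (e : bool) (eta : C) (eps : R)
    (a : nat -> R) (t : R) :
  (eta * eta)%C = RtoC eps -> eps * eps = 1 ->
  mpl_real W e a -> Rabs t < 1 ->
  PSeries (PS_derive (prim_p eps a)) t
  = 2 * eps * t / (1 - eps * t ^ 2) * PSeries a t.
Proof.
  intros He Hs Ha Ht.
  assert (Hr := mpl_real_radius _ _ _ Ha).
  assert (Hb := mpl_real_radius _ _ _ (mpl_real_prim_p _ _ _ _ _ He Hs Ha)).
  set (D := PS_derive (prim_p eps a)).
  assert (HD : ex_pseries D t).
  { apply PSeries_inside; [|exact Ht]. unfold D.
    rewrite CV_radius_derive; exact Hb. }
  assert (HDn : forall n, D n = 2 * fst (pq eps a (S n))).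
  { intros n. exact (PS_derive_div (fun n => 2 * fst (pq eps a n)) n). }
  (* Here two steps of [pq] give [D_n = eps D_(n-2) + 2 eps a_(n-1)]. *)
  assert (E : PSeries D t =
    eps * (t * (t * PSeries D t)) + 2 * eps * (t * PSeries a t)).
  { rewrite <- !PSeries_incr_1, <- !PSeries_scal, <- PSeries_plus.
    - apply PSeries_ext. intros n.
      unfold PS_plus, PS_scal, plus, scal; simpl.
      unfold mult; simpl. rewrite HDn.
      destruct n as [|[|n]]; cbn; unfold zero; simpl; try ring.
      rewrite HDn. cbn. ring.
    - apply ex_pseries_scal; [apply Rmult_comm|].
      now do 2 apply ex_pseries_incr_1.
    - apply ex_pseries_scal; [apply Rmult_comm|].
      apply ex_pseries_incr_1. now apply PSeries_inside. }
  assert (Hd : 1 - eps * t ^ 2 <> 0).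
  { apply Rabs_def2 in Ht. assert (-1 <= eps <= 1) by nra.
    assert (t ^ 2 < 1) by nra. nra. }
  apply Rmult_eq_reg_l with (1 - eps * t ^ 2); [|exact Hd].
  replace ((1 - eps * t ^ 2) * (2 * eps * t / (1 - eps * t ^ 2) * PSeries a t))
    with (2 * eps * (t * PSeries a t)) by (field; exact Hd). nra.
Qed.

(** The difference has zero derivative and vanishes at 0, so the mean value theorem applies. The
    derivative is asked for only when [t > 0], because the kernel [dt/t] is singular at 0. *)
Lemma PSeries_primitive_unique (F : R -> R) (b : nat -> R) :
  Rbar_le 1 (CV_radius b) -> b O = 0 -> F 0 = 0 ->
  (forall t, 0 <= t < 1 -> continuity_pt F t) ->
  (forall t, 0 < t < 1 -> is_derive F t (PSeries (PS_derive b) t)) ->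
  forall t, 0 <= t < 1 -> F t = PSeries b t.
Proof.
  intros Hb H0 HF0 HC HD t Ht.
  assert (Hdisk : forall x, 0 <= x < 1 -> Rbar_lt (Rabs x) (CV_radius b)).
  { intros x Hx. apply inside_disk; [exact Hb|]. rewrite Rabs_pos_eq; lra. }
  destruct (MVT_gen (fun x => F x - PSeries b x) 0 t (fun _ => 0))
    as (c & _ & Hc).
  - intros x. rewrite Rmin_left, Rmax_right by lra. intros Hx.
    replace 0 with (minus (PSeries (PS_derive b) x) (PSeries (PS_derive b) x))
      by (apply Rminus_diag_eq; reflexivity).
    apply (is_derive_minus (V := R_NormedModule)).
    + apply HD; lra.
    + apply is_derive_PSeries, Hdisk; lra.
  - intros x. rewrite Rmin_left, Rmax_right by lra. intros Hx.
    apply continuity_pt_minus; [apply HC; lra|].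
    apply PSeries_continuity, Hdisk; lra.
  - rewrite HF0, PSeries_0, H0 in Hc. lra.
Qed.

(** * Functions of [t] with level 4 Taylor coefficients *)

(** Iterated integrals of weight [W], as functions of [t = tan (theta/2)]; the range of [t]
    corresponds to [0 <= theta < pi/2]. *)
Definition mpl_fun (W : nat) (e : bool) (f : R -> R) : Prop :=
  exists a, mpl_real W e a /\ forall t, 0 <= t < 1 -> f t = PSeries a t.

Definition vanishing_continuous (F : R -> R) : Prop :=
  F 0 = 0 /\ forall t, 0 <= t < 1 -> continuity_pt F t.

Lemma mpl_fun_primitive (W : nat) (e : bool) (b : nat -> R) (F : R -> R) :
  mpl_real W e b -> vanishing_continuous F ->
  (forall t, 0 < t < 1 -> is_derive F t (PSeries (PS_derive b) t)) ->
  mpl_fun W e F.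
Proof.
  intros Hb [HF0 HC] HD. exists b. split; [exact Hb|].
  apply PSeries_primitive_unique; auto.
  - now apply mpl_real_radius with W e.
  - now apply mpl_real_0 with W e.
Qed.

Lemma PSeries_derive_plus (a b : nat -> R) (t : R) :
  Rbar_le 1 (CV_radius a) -> Rbar_le 1 (CV_radius b) -> Rabs t < 1 ->
  PSeries (PS_derive (PS_plus a b)) t =
  PSeries (PS_derive a) t + PSeries (PS_derive b) t.
Proof.
  intros Ha Hb Ht. rewrite <- PSeries_plus.
  - apply PSeries_ext. intros n. unfold PS_derive, PS_plus, plus; simpl. ring.
  - apply PSeries_inside; [rewrite CV_radius_derive|]; assumption.
  - apply PSeries_inside; [rewrite CV_radius_derive|]; assumption.
Qed.

Lemma PSeries_derive_scal (c : R) (a : nat -> R) (t : R) :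
  PSeries (PS_derive (PS_scal c a)) t = c * PSeries (PS_derive a) t.
Proof.
  rewrite <- PSeries_scal. apply PSeries_ext. intros n.
  unfold PS_derive, PS_scal, scal; simpl. unfold mult; simpl. ring.
Qed.

Lemma mpl_fun_scal (W : nat) (e : bool) (q : Q) (f : R -> R) :
  mpl_fun W e f -> mpl_fun W e (fun t => Q2R q * f t).
Proof.
  intros (a & Ha & Hf). exists (PS_scal (Q2R q) a).
  split; [now apply mpl_real_scal|]. intros t Ht.
  now rewrite PSeries_scal, Hf.
Qed.

Lemma mpl_fun_int_dtheta (W : nat) (e : bool) (f F : R -> R) :
  mpl_fun W e f -> vanishing_continuous F ->
  (forall t, 0 < t < 1 -> is_derive F t (2 / (1 + t ^ 2) * f t)) ->
  mpl_fun (S W) (negb e) F.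
Proof.
  intros (a & Ha & Hf) HF HD.
  apply mpl_fun_primitive with (prim_q (-1) a); auto using mpl_real_prim_q.
  intros t Ht. rewrite PSeries_derive_prim_q;
    [|eauto using mpl_real_radius, mpl_real_prim_q..|rewrite Rabs_pos_eq; lra].
  rewrite <- Hf by lra. now apply HD.
Qed.

Lemma neg1_sqr : -1 * -1 = 1. Proof. ring. Qed.
Lemma one_sqr : (RtoC 1 * RtoC 1)%C = RtoC 1. Proof. ring. Qed.

(** The kernel is the logarithmic derivative of [sin theta = 2t / (1 + t^2)]; its second term is the
    even kernel with [eps = -1]. *)
Lemma mpl_fun_int_cot (W : nat) (e : bool) (f F : R -> R) :
  mpl_fun W e f -> vanishing_continuous F ->
  (forall t, 0 < t < 1 ->
     is_derive F t ((/ t - 2 * t / (1 + t ^ 2)) * f t)) ->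
  mpl_fun (S W) e F.
Proof.
  intros (a & Ha & Hf) HF HD.
  assert (H1 := mpl_real_div _ _ _ Ha).
  assert (H2 := mpl_real_prim_p _ _ _ _ _ Ci_sqr neg1_sqr Ha).
  apply mpl_fun_primitive with (1 := mpl_real_plus _ _ _ _ H1 H2); auto.
  intros t Ht. assert (Ht' : Rabs t < 1) by (rewrite Rabs_pos_eq; lra).
  rewrite PSeries_derive_plus; try eapply mpl_real_radius; eauto.
  rewrite (PSeries_derive_div W e) by (try exact Ha; lra).
  rewrite (PSeries_derive_prim_p W e Ci) by
    (try exact Ha; try exact Ci_sqr; lra).
  rewrite <- Hf by lra.
  replace (/ t * f t + 2 * -1 * t / (1 - -1 * t ^ 2) * f t) with
    ((/ t - 2 * t / (1 + t ^ 2)) * f t) by (field; nra).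
  now apply HD.
Qed.

(** The kernel is minus the logarithmic derivative of [cos theta = (1 - t^2) / (1 + t^2)]: the even
    kernel with [eps = 1] minus the one with [eps = -1]. *)
Lemma mpl_fun_int_tan (W : nat) (e : bool) (f F : R -> R) :
  mpl_fun W e f -> vanishing_continuous F ->
  (forall t, 0 < t < 1 ->
     is_derive F t ((2 * t / (1 - t ^ 2) + 2 * t / (1 + t ^ 2)) * f t)) ->
  mpl_fun (S W) e F.
Proof.
  intros (a & Ha & Hf) HF HD.
  assert (H1 := mpl_real_prim_p _ _ _ _ _ one_sqr (Rmult_1_l 1) Ha).
  assert (H2 := mpl_real_prim_p _ _ _ _ _ Ci_sqr neg1_sqr Ha).
  assert (H3 := mpl_real_scal _ _ (-1)%Q _ H2).
  apply mpl_fun_primitive with (1 := mpl_real_plus _ _ _ _ H1 H3); auto.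
  intros t Ht. assert (Ht' : Rabs t < 1) by (rewrite Rabs_pos_eq; lra).
  rewrite PSeries_derive_plus; try eapply mpl_real_radius; eauto.
  rewrite PSeries_derive_scal.
  rewrite (PSeries_derive_prim_p W e (RtoC 1)) by
    (try exact Ha; try exact one_sqr; lra).
  rewrite (PSeries_derive_prim_p W e Ci) by
    (try exact Ha; try exact Ci_sqr; lra).
  rewrite <- Hf by lra.
  replace (Q2R (-1)) with (-1) by (unfold Q2R; simpl; field).
  replace (_ + _) with
    ((2 * t / (1 - t ^ 2) + 2 * t / (1 + t ^ 2)) * f t) by (field; nra).
  now apply HD.
Qed.

(** The constant function 1. Its nonzero constant term keeps it out of [mpl_real], so the innermost
    integration is treated separately. *)
Definition delta0 (n : nat) : R := match n with O => 1 | S _ => 0 end.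

Lemma delta0_radius : Rbar_le 1 (CV_radius delta0).
Proof.
  apply CV_radius_ge_1 with 1. intros [|n]; simpl; rewrite ?Rabs_R1, ?Rabs_R0; lra.
Qed.

Lemma PSeries_delta0 (x : R) : Rabs x < 1 -> PSeries delta0 x = 1.
Proof.
  intros Hx. rewrite PSeries_decr_1
    by (apply PSeries_inside; [apply delta0_radius|exact Hx]).
  rewrite (PSeries_ext _ (fun _ => 0)) by reflexivity.
  rewrite PSeries_const_0. simpl; ring.
Qed.

Lemma kernel_coef_delta0 (eta : C) (n : nat) :
  kernel_coef eta (fun k => (RtoC (delta0 k) * cunit false)%C) (S n)
  = Complex.Cpow eta (S n).
Proof.
  induction n as [|n IH]; [cbn; ring|].
  change (kernel_coef eta ?z (S (S n)))
    with (eta * (kernel_coef eta z (S n) + z (S n)))%C.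
  rewrite IH. cbn. ring.
Qed.

(** This is [i theta = Li_1(i t) - Li_1(-i t)] for [theta = 2 atan t]. *)
Lemma mpl_real_theta : mpl_real 1 true (prim_q (-1) delta0).
Proof.
  assert (He := Ci_sqr).
  assert (He' : (- Ci * - Ci)%C = RtoC (-1)) by (rewrite <- He; ring).
  assert (HV : forall eta, (eta * eta)%C = RtoC (-1) ->
    mpl_seq 4 1 (coef ((1%nat, eta) :: nil))).
  { intros eta E. apply mpl_seq_single. split; [discriminate|].
    split; [|reflexivity]. constructor; [|constructor].
    split; [simpl; lia|]. apply Defs_Cpow_4. cbn [snd].
    rewrite E, <- RtoC_mult. f_equal; ring. }
  eapply mpl_seq_ext; [|exact (mpl_seq_plus _ _ _ _ (HV _ He)
    (mpl_seq_scal _ _ (-1)%Q _ (HV _ He')))].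
  intros [|n]; cbn beta; unfold prim_q.
  - cbn. unfold Rdiv. rewrite Rmult_0_r, Rmult_0_l. ring.
  - rewrite RtoC_div_INR, RtoC_mult by discriminate.
    cbn [coef]. rewrite !Lpart_nil, pow_1, <- !kernel_coef_delta0.
    rewrite (kernel_coef_pq _ _ _ _ _ He).
  rewrite (kernel_coef_pq _ _ _ _ _ He').
    replace (Q2R (-1)) with (Ropp 1) by (unfold Q2R; simpl; field).
    rewrite RtoC_opp. cbn [cunit]. unfold Cdiv; ring.
Qed.

(** * Central binomial ratios and the generating functions *)

Definition binom_ratio (n : nat) : R := / 4 ^ n * central_binom n.

Lemma binom_ratio_S (n : nat) :
  binom_ratio (S n) = binom_ratio n * (2 * INR n + 1) / (2 * INR n + 2).
Proof.
  unfold binom_ratio, central_binom. replace (2 * S n)%nat with (S (S (2 * n))) by lia.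
  rewrite !fact_simpl, !mult_INR, !S_INR, mult_INR. simpl (INR 2).
  rewrite <- tech_pow_Rmult. pose proof (pos_INR n).
  field. repeat split; try apply pow_nonzero; try apply INR_fact_neq_0; lra.
Qed.

Lemma binom_ratio_0 : binom_ratio 0 = 1.
Proof. unfold binom_ratio, central_binom. simpl. field. Qed.

Lemma binom_ratio_pos (n : nat) : 0 < binom_ratio n.
Proof.
  induction n as [|n IH]; [rewrite binom_ratio_0; lra|]. rewrite binom_ratio_S.
  pose proof (pos_INR n). apply Rdiv_lt_0_compat; [nra|lra].
Qed.

(** With [b_n] for [binom_ratio n], [(n+1) b_(n+1) = n b_n + b_n / 2], so [n b_n] increases from its
    value [1/2] at [n = 1]. *)
Lemma inv_binom_ratio_bound (n : nat) : / (INR (S n) * binom_ratio (S n)) <= 2.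
Proof.
  induction n as [|n IH].
  - rewrite binom_ratio_S, binom_ratio_0. simpl. right; field.
  - eapply Rle_trans; [|exact IH]. rewrite (binom_ratio_S (S n)), (S_INR (S n)).
    assert (0 < INR (S n)) by (apply lt_0_INR; lia). pose proof (binom_ratio_pos (S n)).
    apply Rinv_le_contravar; [nra|].
    set (x := INR (S n)) in *. set (b := binom_ratio (S n)) in *.
    replace ((x + 1) * (b * (2 * x + 1) / (2 * x + 2)))
      with (x * b + b / 2) by (field; lra). lra.
Qed.

Lemma H_nil (n : nat) : H n nil = 1.
Proof. now destruct n. Qed.

(** Makes [Lpart_bound] available for [H], with all roots of unity equal to 1. *)
Lemma H_Lpart (n : nat) (w : list nat) :
  RtoC (H n w) = Lpart n (map (fun t => (t, RtoC 1)) w).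
Proof.
  revert w. induction n as [|n IH]; intros [|t w]; try reflexivity.
  cbn [H Lpart map].
  rewrite RtoC_plus, RtoC_mult, RtoC_inv
    by (apply pow_nonzero; now apply not_0_INR).
  rewrite IH, (IH w), Defs_Cpow_eq, Cpow_1_l. cbn [map]. ring.
Qed.

Lemma H_nonneg (n : nat) (w : list nat) : 0 <= H n w.
Proof.
  revert w. induction n as [|n IH]; intros [|t w]; cbn [H]; try lra.
  assert (0 < / INR (S n) ^ t)
    by (apply Rinv_0_lt_compat, pow_lt, lt_0_INR; lia).
  specialize (IH (t :: w)) as IH1. specialize (IH w). nra.
Qed.

Lemma H_bound (w : list nat) : word_ok w ->
  exists M, 0 <= M /\ forall n, H n w <= M * sqrt (INR (S n)).
Proof.
  intros Hw.
  destruct (Lpart_bound 1 (map (fun t => (t, RtoC 1)) w)) as (M & HM & HB).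
  - lia.
  - apply Forall_map. eapply Forall_impl; [|exact Hw].
    intros t Ht. split; [exact Ht|]. cbn. ring.
  - exists M. split; [exact HM|]. intros n. specialize (HB n).
    rewrite <- H_Lpart, Cmod_R, Rabs_pos_eq in HB by apply H_nonneg. exact HB.
Qed.

(** The coefficients of [f_(w,s)] as a power series in [x = y^2]. *)
Definition hcoef (w : list nat) (s n : nat) : R :=
  match n with
  | O => 0
  | S m => H m w / INR n ^ s * / binom_ratio n
  end.

Lemma hcoef_nonneg (w : list nat) (s n : nat) : 0 <= hcoef w s n.
Proof.
  destruct n as [|n]; [simpl; lra|]. cbn [hcoef].
  assert (0 < / INR (S n) ^ s)
    by (apply Rinv_0_lt_compat, pow_lt, lt_0_INR; lia).
  pose proof (H_nonneg n w). pose proof (Rinv_0_lt_compat _ (binom_ratio_pos (S n))).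
  unfold Rdiv. apply Rmult_le_pos; [apply Rmult_le_pos|]; lra.
Qed.

Lemma PS_derive_hcoef (w : list nat) (s n : nat) :
  PS_derive (hcoef w (S s)) n = hcoef w s (S n).
Proof.
  unfold PS_derive. cbn [hcoef]. rewrite <- tech_pow_Rmult. field.
  pose proof (binom_ratio_pos (S n)).
  repeat split; [lra|apply pow_nonzero|]; now apply not_0_INR.
Qed.

Lemma hcoef_radius (w : list nat) (s : nat) :
  word_ok w -> (1 <= s)%nat -> Rbar_le 1 (CV_radius (hcoef w s)).
Proof.
  intros Hw.
  assert (H2 : forall k, Rbar_le 1 (CV_radius (hcoef w (S (S k))))).
  { intros k. destruct (H_bound w Hw) as (M & HM & HB).
    apply CV_radius_ge_1 with (2 * M). intros [|n].
    - simpl. rewrite Rabs_R0. lra.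
    - rewrite Rabs_pos_eq by apply hcoef_nonneg.
      destruct (INR_S_sqrt n) as [Hu Hu2].
      assert (Hp : 1 <= INR (S n)) by nra. specialize (HB n).
      pose proof (inv_binom_ratio_bound n) as Hi.
      pose proof (binom_ratio_pos (S n)) as Hb.
      cbn [hcoef].
      replace (H n w / INR (S n) ^ S (S k) * / binom_ratio (S n)) with
        (H n w * / INR (S n) ^ S k * / (INR (S n) * binom_ratio (S n))).
      2:{ rewrite <- (tech_pow_Rmult _ (S k)). field.
          repeat split; [lra| |lra]. apply pow_nonzero; lra. }
      assert (Hk : H n w * / INR (S n) ^ S k <= M).
      { apply Rmult_le_reg_r with (INR (S n) ^ S k); [apply pow_lt; lra|].
        rewrite Rmult_assoc, Rinv_l, Rmult_1_r by (apply pow_nonzero; lra).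
        eapply Rle_trans; [exact HB|]. apply Rmult_le_compat_l; [exact HM|].
        rewrite <- tech_pow_Rmult.
        assert (1 <= INR (S n) ^ k) by (apply pow_R1_Rle; lra). nra. }
      rewrite (Rmult_comm 2). apply Rmult_le_compat; try assumption.
      + apply Rmult_le_pos; [apply H_nonneg|].
        apply Rlt_le, Rinv_0_lt_compat, pow_lt; lra.
      + apply Rlt_le, Rinv_0_lt_compat; nra. }
  intros Hs. destruct s as [|[|k]]; [lia| |apply H2].
  rewrite (CV_radius_ext _ (PS_incr_1 (PS_derive (hcoef w 2)))).
  - rewrite CV_radius_incr_1, CV_radius_derive. apply H2.
  - intros [|n]; [reflexivity|]. unfold PS_incr_1. now rewrite PS_derive_hcoef.
Qed.

Lemma PSeries_hcoef_pred (w : list nat) (s : nat) (x : R) :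
  x * PSeries (PS_derive (hcoef w (S s))) x = PSeries (hcoef w s) x.
Proof.
  rewrite <- PSeries_incr_1. apply PSeries_ext. intros [|n]; [reflexivity|].
  apply PS_derive_hcoef.
Qed.

(** The inhomogeneous term comes from [H_n(t w') - H_(n-1)(t w') = H_(n-1)(w') / n^t]. For the empty
    word [H] is constant, and only the initial term remains. *)
Definition ode_rhs (w : list nat) : nat -> R :=
  match w with nil => delta0 | t :: w' => hcoef w' t end.

(* Generating-function form of [(2n+1) c_(n+1) = 2n c_n] for
   [c_n = 1 / (n binom_ratio n)]. *)
Lemma hcoef_ode (w : list nat) (x : R) :
  word_ok w -> Rabs x < 1 ->
  let g := PS_derive (hcoef w 2) in
  2 * (1 - x) * (PSeries g x + x * PSeries (PS_derive g) x) - PSeries g x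
  = 2 * PSeries (ode_rhs w) x.
Proof.
  intros Hw Hx g.
  assert (Hg : Rbar_le 1 (CV_radius g)).
  { unfold g. rewrite CV_radius_derive. apply hcoef_radius; [exact Hw|lia]. }
  assert (Hr : Rbar_le 1 (CV_radius (ode_rhs w))).
  { destruct w as [|t w]; [exact delta0_radius|].
    inversion_clear Hw as [|? ? Ht Hw']. now apply hcoef_radius. }
  assert (Eg : ex_pseries g x) by now apply PSeries_inside.
  assert (Eg' : ex_pseries (PS_derive g) x).
  { apply PSeries_inside; [rewrite CV_radius_derive|]; assumption. }
  assert (Er : ex_pseries (ode_rhs w) x) by now apply PSeries_inside.
  (* [A] is the derivative of [x g], with coefficients [(n+1) g_n]. *)
  set (A := PS_plus g (PS_incr_1 (PS_derive g))).
  assert (EA : ex_pseries A x).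
  { apply ex_pseries_plus; [exact Eg|]. now apply ex_pseries_incr_1. }
  assert (HA : PSeries A x = PSeries g x + x * PSeries (PS_derive g) x).
  { unfold A. rewrite PSeries_plus, PSeries_incr_1; auto.
    now apply ex_pseries_incr_1. }
  assert (HAn : forall n, A n = INR (S n) * g n).
  { intros [|n].
    - change (g O + 0 = INR 1 * g O). simpl (INR 1); ring.
    - change (g (S n) + INR (S n) * g (S n) = INR (S (S n)) * g (S n)).
      rewrite (S_INR (S n)); ring. }
  assert (HE : 2 * PSeries A x =
    (2 * (x * PSeries A x) + PSeries g x) + 2 * PSeries (ode_rhs w) x).
  { rewrite <- PSeries_incr_1, <- !PSeries_scal, <- !PSeries_plus.
    - apply PSeries_ext. intros n.
      change (2 * A n = 2 * PS_incr_1 A n + g n + 2 * ode_rhs w n).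
      destruct n as [|n].
      + rewrite HAn. change (PS_incr_1 A O) with 0.
        unfold g. rewrite PS_derive_hcoef. cbn [hcoef].
        rewrite binom_ratio_S, binom_ratio_0.
        destruct w as [|t w]; cbn; field.
      + change (PS_incr_1 A (S n)) with (A n). rewrite !HAn.
        unfold g. rewrite !PS_derive_hcoef.
        cbn [hcoef]. rewrite (binom_ratio_S (S n)), (S_INR (S n)).
        assert (Hn : 0 < INR (S n)) by (apply lt_0_INR; lia).
        pose proof (binom_ratio_pos (S n)) as Hb.
        destruct w as [|t w]; cbn [ode_rhs delta0 hcoef].
        * rewrite !H_nil. field. repeat split; lra.
        * cbn [H]. field. repeat split; try lra. apply pow_nonzero; lra.
    - apply ex_pseries_plus; [|exact Eg].
      apply ex_pseries_scal; [apply Rmult_comm|]. now apply ex_pseries_incr_1.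
    - apply ex_pseries_scal; [apply Rmult_comm|exact Er].
    - apply ex_pseries_scal; [apply Rmult_comm|]. now apply ex_pseries_incr_1.
    - exact Eg. }
  rewrite <- HA. lra.
Qed.

(** * The substitution [theta = 2 atan t] *)

(* Sine and cosine of [theta = 2 atan t], and the derivative of [theta]. *)
Definition sn (t : R) : R := 2 * t / (1 + t ^ 2).
Definition cs (t : R) : R := (1 - t ^ 2) / (1 + t ^ 2).
Definition dth (t : R) : R := 2 / (1 + t ^ 2).

Lemma sn_cs (t : R) : sn t ^ 2 + cs t ^ 2 = 1.
Proof. unfold sn, cs. field. nra. Qed.

Lemma is_derive_sn (t : R) : is_derive sn t (cs t * dth t).
Proof. unfold sn, cs, dth. auto_derive; [nra|]. field. nra. Qed.

Lemma is_derive_cs (t : R) : is_derive cs t (- sn t * dth t).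
Proof. unfold sn, cs, dth. auto_derive; [nra|]. field. nra. Qed.

Lemma cs_pos (t : R) : 0 <= t < 1 -> 0 < cs t.
Proof. intros H. unfold cs. apply Rdiv_lt_0_compat; nra. Qed.

Lemma sn_sqr_lt_1 (t : R) : 0 <= t < 1 -> Rabs (sn t ^ 2) < 1.
Proof.
  intros H. pose proof (sn_cs t). pose proof (cs_pos t H).
  rewrite Rabs_pos_eq by apply pow2_ge_0. nra.
Qed.

Lemma is_derive_PSeries_sn (a : nat -> R) (t : R) :
  Rbar_le 1 (CV_radius a) -> 0 <= t < 1 ->
  is_derive (fun t => PSeries a (sn t ^ 2)) t
    (2 * sn t * cs t * dth t * PSeries (PS_derive a) (sn t ^ 2)).
Proof.
  intros Ha Ht.
  replace (2 * sn t * cs t * dth t * PSeries (PS_derive a) (sn t ^ 2)) with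
    (scal (2 * sn t * cs t * dth t) (PSeries (PS_derive a) (sn t ^ 2)))
    by reflexivity.
  apply (is_derive_comp (PSeries a) (fun t => sn t ^ 2)).
  - apply is_derive_PSeries, inside_disk; [exact Ha|now apply sn_sqr_lt_1].
  - evar_last; [apply is_derive_pow, is_derive_sn|]. simpl. ring.
Qed.

Definition gen (w : list nat) (s : nat) (t : R) : R := PSeries (hcoef w s) (sn t ^ 2).

(* [cot theta * gen w 1], with the singularity at [t = 0] cancelled. *)
Definition gen_cot (w : list nat) (t : R) : R :=
  sn t * cs t * PSeries (PS_derive (hcoef w 2)) (sn t ^ 2).

Lemma continuity_pt_of_derive (F : R -> R) (x l : R) :
  is_derive F x l -> continuity_pt F x.
Proof.
  intros H. apply continuity_pt_filterlim.
  apply (ex_derive_continuous F). now exists l.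
Qed.

(** Per [dtheta], the derivative of [sin cos G(sin^2)] is [(cos^2 - sin^2) G + 2 sin^2 cos^2 G']. At
    [x = sin^2] this is the left side of [hcoef_ode]. *)
Lemma is_derive_gen_cot (w : list nat) (t : R) :
  word_ok w -> 0 <= t < 1 ->
  is_derive (gen_cot w) t (2 * dth t * PSeries (ode_rhs w) (sn t ^ 2)).
Proof.
  intros Hw Ht. set (g := PS_derive (hcoef w 2)).
  assert (Hg : Rbar_le 1 (CV_radius g)).
  { unfold g. rewrite CV_radius_derive. apply hcoef_radius; [exact Hw|lia]. }
  assert (Hode := hcoef_ode w (sn t ^ 2) Hw (sn_sqr_lt_1 t Ht)).
  fold g in Hode. cbv zeta in Hode.
  assert (Hc : cs t ^ 2 = 1 - sn t ^ 2) by (pose proof (sn_cs t); lra).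
  evar_last.
  - unfold gen_cot. fold g.
    apply (is_derive_mult (fun t => sn t * cs t)
             (fun t => PSeries g (sn t ^ 2))).
    + apply (is_derive_mult sn cs); [apply is_derive_sn|apply is_derive_cs|].
      intros; apply Rmult_comm.
    + now apply is_derive_PSeries_sn.
    + intros; apply Rmult_comm.
  - unfold plus, mult; simpl. unfold mult; simpl.
    set (G := PSeries g (sn t * (sn t * 1))) in *.
    change (sn t ^ 2) with (sn t * (sn t * 1)) in *. fold G in Hode.
    set (G1 := PSeries (PS_derive g) _) in *.
    set (P := PSeries (ode_rhs w) _) in *.
    transitivity (dth t * ((cs t ^ 2 - sn t ^ 2) * G
      + 2 * sn t ^ 2 * cs t ^ 2 * G1)); [ring|].
    transitivity (dth t * (2 * P)); [|ring].
    rewrite <- Hode, Hc. ring.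
Qed.

Lemma vanishing_gen_cot (w : list nat) : word_ok w -> vanishing_continuous (gen_cot w).
Proof.
  intros Hw. split.
  - unfold gen_cot, sn. unfold Rdiv. rewrite Rmult_0_r, !Rmult_0_l. reflexivity.
  - intros t Ht. eapply continuity_pt_of_derive. now apply is_derive_gen_cot.
Qed.

Lemma is_derive_gen (w : list nat) (s : nat) (t : R) :
  word_ok w -> 0 <= t < 1 ->
  is_derive (gen w (S s)) t
    (2 * sn t * cs t * dth t * PSeries (PS_derive (hcoef w (S s))) (sn t ^ 2)).
Proof.
  intros Hw Ht. apply is_derive_PSeries_sn; [|exact Ht].
  apply hcoef_radius; [exact Hw|lia].
Qed.

Lemma vanishing_gen (w : list nat) (s : nat) :
  word_ok w -> vanishing_continuous (gen w (S s)).
Proof.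
  intros Hw. split.
  - unfold gen. replace (sn 0 ^ 2) with 0 by (unfold sn; field).
    now rewrite PSeries_0.
  - intros t Ht. eapply continuity_pt_of_derive. now apply is_derive_gen.
Qed.

(** * The generating functions as iterated integrals *)

Lemma gen_1 (w : list nat) (t : R) :
  0 <= t < 1 -> gen w 1 t = sn t / cs t * gen_cot w t.
Proof.
  intros Ht. pose proof (cs_pos t Ht). unfold gen, gen_cot.
  rewrite <- (PSeries_hcoef_pred w 1). field. lra.
Qed.

Lemma Q2R_2 : Q2R 2 = 2.
Proof. unfold Q2R; simpl; field. Qed.

(** One [dtheta] integration of [2 gen_cot w] gives exponent 2 and makes the parity even; each
    further exponent is one [cot theta dtheta] integration, which keeps it. *)
Lemma mpl_fun_gen (w : list nat) (W k : nat) :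
  word_ok w -> mpl_fun W true (gen_cot w) ->
  mpl_fun (S k + W) false (gen w (S (S k))).
Proof.
  intros Hw HE. induction k as [|k IH].
  - apply (mpl_fun_int_dtheta W true (fun t => Q2R 2 * gen_cot w t)).
    + now apply mpl_fun_scal.
    + now apply vanishing_gen.
    + intros t Ht. rewrite Q2R_2.
      evar_last; [apply is_derive_gen; [exact Hw|lra]|].
      unfold gen_cot, dth. field. nra.
  - apply (mpl_fun_int_cot (S k + W) false (fun t => Q2R 2 * gen w (S (S k)) t)).
    + now apply mpl_fun_scal.
    + now apply vanishing_gen.
    + intros t Ht. rewrite Q2R_2.
      evar_last; [apply is_derive_gen; [exact Hw|lra]|].
      unfold gen. rewrite <- (PSeries_hcoef_pred w (S (S k))).
      unfold sn at 1 3, cs, dth. field. split; nra.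
Qed.

Lemma mpl_fun_gen_cot (w : list nat) :
  word_ok w -> mpl_fun (S (weight w)) true (gen_cot w).
Proof.
  intros Hw. induction w as [|t w IH].
  (* Empty word: [gen_cot nil] is [2 theta]. *)
  - assert (Hb := mpl_real_theta). apply (mpl_real_scal _ _ 2%Q) in Hb.
    apply mpl_fun_primitive with (1 := Hb); [now apply vanishing_gen_cot|].
    intros t Ht. rewrite PSeries_derive_scal, Q2R_2.
    rewrite PSeries_derive_prim_q.
    + evar_last; [apply is_derive_gen_cot; [exact Hw|lra]|].
      cbn [ode_rhs]. rewrite !PSeries_delta0; [unfold dth; ring| |].
      * rewrite Rabs_pos_eq; lra.
      * apply sn_sqr_lt_1; lra.
    + exact delta0_radius.
    + exact (mpl_real_radius _ _ _ mpl_real_theta).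
    + rewrite Rabs_pos_eq; lra.
  - inversion_clear Hw as [|? ? Ht Hw']. assert (Hw : word_ok (t :: w))
      by now constructor.
    specialize (IH Hw'). destruct t as [|[|k]]; [lia| |].
    (* First exponent 1: [gen w 1] is [tan theta] times [gen_cot w], so one [tan theta dtheta]
       integration suffices and the parity stays odd. *)
    + apply (mpl_fun_int_tan (S (weight w)) true (fun t => Q2R 2 * gen_cot w t)).
      * now apply mpl_fun_scal.
      * now apply vanishing_gen_cot.
      * intros t Htt. rewrite Q2R_2.
        evar_last; [apply is_derive_gen_cot; [exact Hw|lra]|].
        cbn [ode_rhs]. change (PSeries (hcoef w 1) (sn t ^ 2)) with (gen w 1 t).
        rewrite gen_1 by lra. unfold sn, cs, dth. field. repeat split; nra.
    (* First exponent [k + 2]: one [dtheta] inside [mpl_fun_gen] and one here, so the parity is odd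
       again. *)
    + replace (S (weight (S (S k) :: w))) with (S (S k + S (weight w)))
        by (change (weight (S (S k) :: w)) with (S (S k) + weight w)%nat; lia).
      apply (mpl_fun_int_dtheta (S k + S (weight w)) false
        (fun t => Q2R 2 * gen w (S (S k)) t)).
      * now apply mpl_fun_scal, mpl_fun_gen.
      * now apply vanishing_gen_cot.
      * intros t Htt. rewrite Q2R_2.
        evar_last; [apply is_derive_gen_cot; [exact Hw|lra]|].
        cbn [ode_rhs]. unfold gen, dth. field. nra.
Qed.

(** * Wallis integrals *)

(* [sin_int m t] is the integral of [sin^(2m+1)] from [0] to [2 atan t]. *)
Fixpoint sin_int (m : nat) (t : R) : R :=
  match m with
  | O => 1 - cs t
  | S p => (2 * INR m * sin_int p t - sn t ^ (2 * m) * cs t) / (2 * INR m + 1)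
  end.

(** The recursion is the reduction formula from integration by parts; differentiating it closes up
    through [1 - cos^2 = sin^2]. *)
Lemma is_derive_sin_int (m : nat) (t : R) :
  is_derive (sin_int m) t (dth t * sn t ^ (2 * m + 1)).
Proof.
  induction m as [|m IH].
  - evar_last.
    + apply (is_derive_minus (V := R_NormedModule));
        [apply is_derive_const|apply is_derive_cs].
    + unfold minus, plus, opp, zero; simpl. ring.
  - pose proof (pos_INR (S m)) as Hp. pose proof (sn_cs t) as Hc.
    apply (is_derive_ext (fun t => scal (/ (2 * INR (S m) + 1))
      (minus (scal (2 * INR (S m)) (sin_int m t)) (mult (sn t ^ (2 * S m)) (cs t))))).
    { intros x. cbn [sin_int]. unfold scal, minus, plus, opp, mult; simpl.
      unfold mult; simpl. unfold Rdiv. rewrite Rmult_comm. reflexivity. }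
    evar_last.
    + apply is_derive_scal, (is_derive_minus (V := R_NormedModule)).
      * apply is_derive_scal, IH.
      * apply (is_derive_mult (fun t => sn t ^ (2 * S m)) cs);
          [apply (is_derive_pow sn), is_derive_sn|apply is_derive_cs|].
        intros; apply Rmult_comm.
    + unfold scal, minus, plus, opp, mult; cbn -[INR Nat.mul pow].
      unfold mult; cbn -[INR Nat.mul pow].
      replace (Init.Nat.pred (2 * S m)) with (2 * m + 1)%nat by lia.
      replace (2 * S m + 1)%nat with (S (S (2 * m + 1))) by lia.
      replace (2 * S m)%nat with (S (2 * m + 1)) by lia.
      replace (INR (S (2 * m + 1))) with (2 * INR (S m)).
      2:{ rewrite !S_INR, plus_INR, mult_INR. simpl. ring. }
      rewrite <- !tech_pow_Rmult.
      set (u := sn t ^ (2 * m + 1)).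
      transitivity (/ (2 * INR (S m) + 1) * (dth t * u *
        (2 * INR (S m) * (1 - cs t ^ 2) + sn t ^ 2))); [ring|].
      replace (1 - cs t ^ 2) with (sn t ^ 2) by lra. field. lra.
Qed.

Lemma sin_int_0 (m : nat) : sin_int m 0 = 0.
Proof.
  assert (Hs : sn 0 = 0) by (unfold sn; field).
  assert (Hc : cs 0 = 1) by (unfold cs; field).
  induction m as [|m IH]; cbn [sin_int]; [rewrite Hc; ring|].
  rewrite IH, Hs, pow_i by lia. unfold Rdiv; ring.
Qed.

(** At [theta = pi/2] the boundary term vanishes, and the remaining factor [2m / (2m+1)] is exactly
    the ratio of successive right-hand sides. *)
Lemma sin_int_1 (m : nat) : sin_int m 1 = / (2 * INR (S m) * binom_ratio (S m)).
Proof.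
  assert (Hc : cs 1 = 0) by (unfold cs; field).
  induction m as [|m IH].
  - cbn [sin_int]. rewrite Hc, binom_ratio_S, binom_ratio_0. simpl; field.
  - cbn [sin_int]. rewrite Hc, IH, (binom_ratio_S (S m)), (S_INR (S m)).
    assert (0 < INR (S m)) by (apply lt_0_INR; lia).
    pose proof (binom_ratio_pos (S m)). field. repeat split; lra.
Qed.

Lemma le_of_derive_nonneg (F F' : R -> R) (a b : R) :
  a <= b -> (forall x, a <= x <= b -> continuity_pt F x) ->
  (forall x, a < x < b -> is_derive F x (F' x)) ->
  (forall x, a <= x <= b -> 0 <= F' x) -> F a <= F b.
Proof.
  intros Hab HC HD HF.
  destruct (MVT_gen F a b F') as (c & Hc & Hi);
    rewrite ?Rmin_left, ?Rmax_right in * by lra; auto.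
  specialize (HF c Hc). nra.
Qed.

Lemma sin_int_le_1 (m : nat) (t : R) : 0 <= t <= 1 -> sin_int m t <= sin_int m 1.
Proof.
  intros Ht. apply le_of_derive_nonneg with
    (fun t => dth t * sn t ^ (2 * m + 1)); [lra| | |].
  - intros x _. eapply continuity_pt_of_derive, is_derive_sin_int.
  - intros x _. apply is_derive_sin_int.
  - intros x Hx. apply Rmult_le_pos.
    + unfold dth. apply Rlt_le, Rdiv_lt_0_compat; nra.
    + apply pow_le. unfold sn. apply Rmult_le_pos; [lra|].
      apply Rlt_le, Rinv_0_lt_compat; nra.
Qed.

Lemma sn_le (t r : R) : 0 <= t <= r -> r <= 1 -> 0 <= sn t <= sn r.
Proof.
  intros Ht Hr. split.
  - unfold sn. apply Rmult_le_pos; [lra|].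
    apply Rlt_le, Rinv_0_lt_compat; nra.
  - apply le_of_derive_nonneg with (fun t => cs t * dth t); [lra| | |].
    + intros x _. eapply continuity_pt_of_derive, is_derive_sn.
    + intros x _. apply is_derive_sn.
    + intros x Hx. unfold cs, dth.
      apply Rmult_le_pos; apply Rmult_le_pos; try nra;
        apply Rlt_le, Rinv_0_lt_compat; nra.
Qed.

(** * Termwise integration up to [t = 1] *)

Definition psum (u : nat -> R) (x : R) (N : nat) : R :=
  sum_n (fun m => u m * x ^ m) N.

Definition sin_int_sum (u : nat -> R) (N : nat) (t : R) : R :=
  sum_n (fun m => u m * sin_int m t) N.

Lemma is_derive_sin_int_sum (u : nat -> R) (N : nat) (t : R) :
  is_derive (sin_int_sum u N) t (dth t * sn t * psum u (sn t ^ 2) N).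
Proof.
  induction N as [|N IH].
  - apply (is_derive_ext (fun t => scal (u O) (sin_int O t))).
    { intros x. unfold sin_int_sum. now rewrite sum_O. }
    evar_last; [apply is_derive_scal, is_derive_sin_int|].
    unfold psum. rewrite sum_O. unfold scal; simpl. unfold mult; simpl. ring.
  - apply (is_derive_ext (fun t => plus (sin_int_sum u N t)
      (scal (u (S N)) (sin_int (S N) t)))).
    { intros x. unfold sin_int_sum. now rewrite sum_Sn. }
    evar_last; [apply (is_derive_plus (V := R_NormedModule));
      [exact IH|apply is_derive_scal, is_derive_sin_int]|].
    unfold psum. rewrite sum_Sn. rewrite <- pow_mult.
    rewrite pow_add, pow_1. unfold plus, scal; cbn -[Nat.mul pow sum_n].
    unfold mult; cbn -[Nat.mul pow sum_n]. ring.
Qed.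

Lemma psum_lim (u : nat -> R) (x : R) :
  Rbar_le 1 (CV_radius u) -> Rabs x < 1 ->
  is_lim_seq (psum u x) (PSeries u x).
Proof.
  intros Hu Hx. pose proof (PSeries_correct u x (PSeries_inside u x Hu Hx)) as H.
  eapply is_lim_seq_ext; [|exact H]. intros n. apply sum_n_ext. intros k.
  unfold scal; simpl. unfold mult; simpl. rewrite pow_n_pow. apply Rmult_comm.
Qed.

(** With nonnegative coefficients every finite section of the tail is monotone in [x]; the infinite
    tail inherits this in the limit. *)
Lemma psum_tail (u : nat -> R) (x r : R) (N : nat) :
  (forall m, 0 <= u m) -> Rbar_le 1 (CV_radius u) -> 0 <= x <= r -> r < 1 ->
  0 <= PSeries u x - psum u x N <= PSeries u r - psum u r N.
Proof.
  intros Hu Hr Hx Hr1.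
  assert (HM : forall k, 0 <= psum u x (N + k) - psum u x N
    <= psum u r (N + k) - psum u r N).
  { induction k as [|k IH]; [rewrite Nat.add_0_r; lra|].
    rewrite Nat.add_succ_r. unfold psum in *. rewrite !sum_Sn.
    unfold plus; cbn -[pow sum_n]. specialize (Hu (S (N + k))).
    assert (0 <= x ^ S (N + k)) by (apply pow_le; lra).
    assert (x ^ S (N + k) <= r ^ S (N + k)) by (apply pow_incr; lra).
    nra. }
  assert (HL : forall y, 0 <= y < 1 ->
    is_lim_seq (fun k => psum u y (N + k) - psum u y N)
      (PSeries u y - psum u y N)).
  { intros y Hy. apply is_lim_seq_minus'; [|apply is_lim_seq_const].
    apply (is_lim_seq_ext (fun k => psum u y (k + N))).
    { intros k. now rewrite Nat.add_comm. }
    apply is_lim_seq_incr_n, psum_lim; [exact Hr|].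
    rewrite Rabs_pos_eq; lra. }
  split.
  - refine (is_lim_seq_le _ _ 0 (PSeries u x - psum u x N) _
      (is_lim_seq_const 0) (HL x _)); [|lra].
    intros k. apply HM.
  - refine (is_lim_seq_le _ _ (PSeries u x - psum u x N)
      (PSeries u r - psum u r N) _ (HL x _) (HL r _)); [|lra|lra].
    intros k. apply HM.
Qed.

(** If the radius exceeds 1 this is continuity inside the disk; if it equals 1 it is Abel's
    theorem. *)
Lemma Abel_at_1 (b : nat -> R) (l : R) :
  Rbar_le 1 (CV_radius b) -> is_series b l ->
  filterlim (PSeries b) (at_left 1) (locally l).
Proof.
  intros Hb Hl.
  assert (Hp : is_pseries b 1 l).
  { eapply is_series_ext; [|exact Hl]. intros n. unfold scal; simpl.
    unfold mult; simpl. rewrite pow_n_pow, pow1. symmetry. apply Rmult_1_l. }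
  assert (E : PSeries b 1 = l) by (now apply is_pseries_unique).
  destruct (Rbar_le_lt_or_eq_dec _ _ Hb) as [Hlt|Heq].
  - assert (HC : continuity_pt (PSeries b) 1).
    { apply PSeries_continuity. now rewrite Rabs_R1. }
    apply continuity_pt_filterlim in HC. rewrite E in HC.
    eapply filterlim_filter_le_1; [|exact HC]. apply filter_le_within.
  - pose proof (Abel b) as HA. rewrite <- Heq in HA. cbn [real] in HA.
    rewrite E in HA. apply HA; [simpl; lra|exact I|]. now exists l.
Qed.

(** Summation and integration are exchanged by positivity: the partial sums at 1 increase to some
    [L <= l], while [PSeries b r <= L] for all [r < 1] gives [l <= L] as [r] tends to 1. *)
Lemma sin_int_sum_lim (u b : nat -> R) (l : R) :
  (forall m, 0 <= u m) -> Rbar_le 1 (CV_radius u) ->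
  Rbar_le 1 (CV_radius b) -> b O = 0 -> is_series b l ->
  (forall t, 0 < t < 1 ->
     PSeries (PS_derive b) t = dth t * sn t * PSeries u (sn t ^ 2)) ->
  is_series (fun m => u m * sin_int m 1) l.
Proof.
  intros Hu Hru Hrb Hb0 Hl HD.
  assert (Hin : forall t, 0 <= t < 1 -> 0 <= sn t ^ 2 < 1).
  { intros t Ht. pose proof (sn_cs t). pose proof (cs_pos t Ht). nra. }
  assert (Hdth : forall t, 0 <= dth t <= 2).
  { intros t. unfold dth. assert (0 < / (1 + t ^ 2) <= 1).
    { split; [apply Rinv_0_lt_compat; nra|].
      rewrite <- Rinv_1. apply Rinv_le_contravar; nra. }
    unfold Rdiv; lra. }
  assert (Hsn : forall t, 0 <= t < 1 -> 0 <= sn t <= 1).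
  { intros t Ht. split; [apply (sn_le t t); lra|]. specialize (Hin t Ht). nra. }
  assert (HDN : forall N t, 0 < t < 1 ->
    is_derive (fun t => PSeries b t - sin_int_sum u N t) t
      (dth t * sn t * (PSeries u (sn t ^ 2) - psum u (sn t ^ 2) N))).
  { intros N t Ht. evar_last.
    - apply (is_derive_minus (V := R_NormedModule));
        [apply is_derive_PSeries, inside_disk;
          [exact Hrb|rewrite Rabs_pos_eq; lra]|apply is_derive_sin_int_sum].
    - rewrite HD by lra. unfold minus, plus, opp; cbn -[pow]. ring. }
  assert (HCN : forall N t, 0 <= t < 1 ->
    continuity_pt (fun t => PSeries b t - sin_int_sum u N t) t).
  { intros N t Ht. apply continuity_pt_minus.
    - apply PSeries_continuity, inside_disk;
        [exact Hrb|rewrite Rabs_pos_eq; lra].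
    - eapply continuity_pt_of_derive, is_derive_sin_int_sum. }
  assert (H0 : forall N, PSeries b 0 - sin_int_sum u N 0 = 0).
  { intros N. rewrite PSeries_0, Hb0. unfold sin_int_sum.
    rewrite (sum_n_ext _ (fun _ => 0)), sum_n_const; [ring|].
    intros m. rewrite sin_int_0. apply Rmult_0_r. }
  assert (Hlow : forall N t, 0 <= t < 1 -> sin_int_sum u N t <= PSeries b t).
  { intros N t Ht.
    assert (HI : PSeries b 0 - sin_int_sum u N 0 <= PSeries b t - sin_int_sum u N t).
    { apply (le_of_derive_nonneg (fun t => PSeries b t - sin_int_sum u N t)
        (fun t => dth t * sn t * (PSeries u (sn t ^ 2) - psum u (sn t ^ 2) N)));
        [lra| | |].
      - intros x Hx. apply HCN; lra.
      - intros x Hx. apply HDN; lra.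
      - intros x Hx. assert (Hx' : 0 <= x < 1) by lra.
        apply Rmult_le_pos; [apply Rmult_le_pos; [apply Hdth|now apply Hsn]|].
        destruct (Hin x Hx'). apply (psum_tail u _ (sn x ^ 2)); auto; lra. }
    rewrite H0 in HI. lra. }
  (* On [[0, r]] the integrand of the remainder is at most [2 T]: [dth <= 2], [sn <= 1], and the
     tail is largest at [r]. The interval has length below 1. *)
  assert (Hup : forall N r, 0 <= r < 1 ->
    PSeries b r <= sin_int_sum u N r
      + 2 * (PSeries u (sn r ^ 2) - psum u (sn r ^ 2) N)).
  { intros N r Hr. set (T := PSeries u (sn r ^ 2) - psum u (sn r ^ 2) N).
    destruct (Hin r Hr) as [Hr1 Hr2].
    assert (HT : 0 <= T) by (apply (psum_tail u _ (sn r ^ 2)); auto; lra).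
    assert (HI : 2 * T * 0 - (PSeries b 0 - sin_int_sum u N 0)
      <= 2 * T * r - (PSeries b r - sin_int_sum u N r)).
    { apply (le_of_derive_nonneg
        (fun t => 2 * T * t - (PSeries b t - sin_int_sum u N t))
        (fun t => 2 * T -
           dth t * sn t * (PSeries u (sn t ^ 2) - psum u (sn t ^ 2) N)));
        [lra| | |].
      - intros x Hx. apply continuity_pt_minus; [|apply HCN; lra].
        apply continuity_pt_mult; [now apply continuity_pt_const|].
        apply continuity_pt_id.
      - intros x Hx. apply (is_derive_minus (V := R_NormedModule)).
        + evar_last; [apply (is_derive_scal (fun t => t)), is_derive_id|].
          unfold scal, one; simpl. unfold mult; simpl. ring.
        + apply HDN; lra.
      - intros x Hx. assert (Hx' : 0 <= x < 1) by lra.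
        destruct (sn_le x r) as [Hs1 Hs2]; [lra|lra|].
        assert (HTx : 0 <= PSeries u (sn x ^ 2) - psum u (sn x ^ 2) N <= T)
          by (apply psum_tail; auto; split; [apply pow2_ge_0|apply pow_incr; lra]).
        specialize (Hdth x). specialize (Hsn x Hx').
        assert (0 <= dth x * sn x <= 2) by nra. nra. }
    rewrite H0 in HI. nra. }
  assert (Hleft : at_left 1 (fun t => 0 <= t < 1)).
  { exists (mkposreal (1 / 2) ltac:(lra)). intros t Hb Ht.
    unfold ball in Hb; simpl in Hb. unfold AbsRing_ball, abs, minus, plus, opp in Hb;
    simpl in Hb. apply Rabs_def2 in Hb. lra. }
  assert (HA := Abel_at_1 b l Hrb Hl).
  assert (HS : forall N, sin_int_sum u N 1 <= l).
  { intros N. refine (filterlim_le (F := at_left 1) (sin_int_sum u N) (PSeries b)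
      (sin_int_sum u N 1) l _ _ HA).
    - eapply filter_imp; [|exact Hleft]. intros t Ht. now apply Hlow.
    - eapply filterlim_filter_le_1; [apply filter_le_within|].
      apply continuity_pt_filterlim.
      eapply continuity_pt_of_derive, is_derive_sin_int_sum. }
  assert (HJ1 : forall m, 0 <= sin_int m 1).
  { intros m. rewrite sin_int_1. apply Rlt_le, Rinv_0_lt_compat.
    assert (0 < INR (S m)) by (apply lt_0_INR; lia).
    pose proof (binom_ratio_pos (S m)). nra. }
  assert (Hinc : forall N, sin_int_sum u N 1 <= sin_int_sum u (S N) 1).
  { intros N. unfold sin_int_sum. rewrite sum_Sn. unfold plus; cbn -[sum_n sin_int].
    specialize (HJ1 (S N)). specialize (Hu (S N)). nra. }
  destruct (ex_finite_lim_seq_incr (fun N => sin_int_sum u N 1) l Hinc HS) as [L HL].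
  assert (HLl : L <= l).
  { exact (is_lim_seq_le _ _ L l HS HL (is_lim_seq_const l)). }
  (* For fixed [r] the tail in [Hup] tends to 0 with [N], and the partial sums at [r] are at most
     those at 1. *)
  assert (HrL : forall r, 0 <= r < 1 -> PSeries b r <= L).
  { intros r Hr. destruct (Hin r Hr) as [Hr1 Hr2].
    assert (Hlim : is_lim_seq (fun N => sin_int_sum u N 1
      + 2 * (PSeries u (sn r ^ 2) - psum u (sn r ^ 2) N))
      (L + 2 * (PSeries u (sn r ^ 2) - PSeries u (sn r ^ 2)))).
    { apply is_lim_seq_plus'; [exact HL|].
      apply (is_lim_seq_scal_l _ 2
        (PSeries u (sn r ^ 2) - PSeries u (sn r ^ 2))).
      apply is_lim_seq_minus'; [apply is_lim_seq_const|].
      apply psum_lim; [exact Hru|rewrite Rabs_pos_eq; lra]. }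
    replace L with (L + 2 * (PSeries u (sn r ^ 2) - PSeries u (sn r ^ 2))) by ring.
    refine (is_lim_seq_le _ _ (PSeries b r) _ _ (is_lim_seq_const _) Hlim).
    intros N. eapply Rle_trans; [apply Hup, Hr|]. apply Rplus_le_compat_r.
    apply sum_n_m_le. intros m. apply Rmult_le_compat_l; [apply Hu|].
    apply sin_int_le_1; lra. }
  assert (HlL : l <= L).
  { refine (filterlim_le (F := at_left 1) (PSeries b) (fun _ => L)
      l L _ HA (filterlim_const L)).
    eapply filter_imp; [|exact Hleft]. exact HrL. }
  replace l with L by lra. exact HL.
Qed.

(** * Identification of the sum with a combination of [L]-values *)

Lemma is_series_RtoC (b : nat -> R) (v : C) :
  is_series (V := C_NormedModule) (fun n => RtoC (b n)) v ->
  is_series b (fst v) /\ v = RtoC (fst v).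
Proof.
  intros Hv.
  assert (Hs : forall n, sum_n (G := C_AbelianMonoid) (fun n => RtoC (b n)) n
    = RtoC (sum_n b n)).
  { induction n as [|n IH]; [now rewrite !sum_O|].
    rewrite !sum_Sn, IH. symmetry. apply RtoC_plus. }
  assert (HF : filterlim (fun n => RtoC (sum_n b n)) eventually (locally v)).
  { eapply filterlim_ext; [exact Hs|exact Hv]. }
  assert (H1 : is_lim_seq (sum_n b) (fst v)).
  { apply (filterlim_comp _ _ _ (fun n => RtoC (sum_n b n)) fst _ (locally v));
      [exact HF|]. destruct v; apply continuous_fst. }
  assert (H2 : is_lim_seq (fun _ => 0) (snd v)).
  { apply (filterlim_comp _ _ _ (fun n => RtoC (sum_n b n)) snd _ (locally v));
      [exact HF|]. destruct v; apply continuous_snd. }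
  split; [exact H1|].
  apply is_lim_seq_unique in H2. rewrite Lim_seq_const in H2.
  injection H2 as H2. destruct v as [v1 v2]. simpl in *. now rewrite <- H2.
Qed.

Theorem theorem4p15 (w : list nat) (s : nat) :
  word_ok w -> (3 <= s)%nat ->
  exists l : R,
    is_series (fun k => term w s (S k)) l /\
    in_CMZV 4 (s + weight w) (RtoC l).
Proof.
  intros Hw Hs. destruct s as [|[|[|k]]]; try lia.
  (* With [s = k + 3] the function [2 f_(w,s-1)] has exponent at least 2, hence even parity;
     dividing its coefficients by [n] is the outermost [dt/t] integration. *)
  destruct (mpl_fun_scal _ _ 2%Q _ (mpl_fun_gen w _ k Hw (mpl_fun_gen_cot w Hw)))
    as (a & Ha & Hf).
  destruct (mpl_seq_div_series 4 _ _ (Nat.lt_0_succ 3) Ha) as (v & Hv & HC).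
  assert (Hb := mpl_real_div _ _ _ Ha). set (b := fun n => a n / INR n) in Hb.
  assert (Eb : forall n, (RtoC (a n) * cunit false / RtoC (INR n))%C = RtoC (b n)).
  { intros [|n]; cbn [cunit]; unfold b.
    - rewrite (mpl_real_0 _ _ _ Ha). unfold Rdiv, Cdiv. rewrite Rmult_0_l. ring.
    - rewrite RtoC_div_INR by discriminate. unfold Cdiv. ring. }
  apply (is_series_ext _ _ _ Eb) in Hv.
  apply is_series_RtoC in Hv as [Hl Hv].
  exists (fst v). split.
  (* The index shift [n = m + 1] accounts for dividing by the sine:
     [sin^(2n) / sin = sin^(2m+1)]. *)
  - set (u := PS_scal 2 (PS_derive (hcoef w (S (S (S k)))))).
    assert (Hun : forall m, u m = 2 * hcoef w (S (S k)) (S m)).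
    { intros m. unfold u, PS_scal. rewrite PS_derive_hcoef. reflexivity. }
    assert (Et : forall m, u m * sin_int m 1 = term w (S (S (S k))) (S m)).
    { intros m. rewrite Hun, sin_int_1. unfold term. cbn [hcoef].
      replace (S m - 1)%nat with m by lia. fold (binom_ratio (S m)).
      assert (Hn : 0 < INR (S m)) by (apply lt_0_INR; lia).
      pose proof (binom_ratio_pos (S m)) as Hbn.
      rewrite <- (tech_pow_Rmult _ (S (S k))). field.
      repeat split; try lra; apply pow_nonzero; lra. }
    apply (is_series_ext _ _ _ Et), (sin_int_sum_lim u b); auto.
    + intros m. rewrite Hun. pose proof (hcoef_nonneg w (S (S k)) (S m)). lra.
    + unfold u. rewrite CV_radius_scal by lra. rewrite CV_radius_derive.
      apply hcoef_radius; [exact Hw|lia].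
    + exact (mpl_real_radius _ _ _ Hb).
    + exact (mpl_real_0 _ _ _ Hb).
    (* Both sides are [2 f_(w,s-1) / t], because [dth t / sn t = 1 / t]. *)
    + intros t Ht. unfold b.
      rewrite (PSeries_derive_div _ _ _ _ Ha) by lra.
      rewrite <- Hf by lra. rewrite Q2R_2. unfold gen, u.
      rewrite PSeries_scal, <- (PSeries_hcoef_pred w (S (S k))).
      unfold sn at 1 3, dth. field. split; nra.
  - rewrite <- Hv.
    replace (S (S (S k)) + weight w)%nat with (S (S k + S (weight w))) by lia.
    exact HC.
Qed.
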